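(* Let $X$ be a pseudocompact Tychonoff space. The following conditions (1)–(6) are equivalent: (1) $X$ is weakly pc-Grothendieck; (2) $X$ is pc-Grothendieck; (3) $X$ is pe-Grothendieck; (4) $X$ is pf-Grothendieck; (5) for any pseudocompact $Y\subset C_p(X)$, one of the following conditions, which are equivalent to each other for each such $Y$, is satisfied: (a) the closure $\overline{Y}$ of $Y$ in $C_p(X)$ is compact; (b) $Y$ is compact; (c) $Y$ is an Eberlein compactum; (d) $Y$ is weakly pc-Grothendieck; (e) the set of those $f\in Y$ at which the restrictions to $Y$ of the topologies of pointwise and uniform convergence coincide is dense in $Y$; (f) $\{f\in Y:\chi(f,Y)\le\omega\}$ is dense in $Y$; (g) $\{f\in Y:\pi\chi(f,Y)\le\omega\}$ is dense in $Y$; (6) for any pseudocompact Tychonoff space $Y$, one of the following conditions, which are equivalent to each other for each such $Y$, is satisfied: (a) $(X,Y)$ is a Grothendieck pair; (b) $(Y,X)$ is a Grothendieck pair; (c) $X$ and $Y$ satisfy the Namioka property $\mathcal{N}(X,Y)$; (d) $Y$ and $X$ satisfy the Namioka property $\mathcal{N}(Y,X)$.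
   Context: All spaces are Tychonoff; a space is pseudocompact if every continuous real-valued function on it is bounded. $\beta X$ is the Stone–Čech compactification of $X$. $C_p(X)$ is the space of continuous functions $X\to\mathbb{R}$ with the topology of pointwise convergence; subsets $Y\subset C_p(X)$ carry the subspace topology of $C_p(X)$. An Eberlein compactum is a compact space homeomorphic to a weakly compact subset of a Banach space. A space $X$ is: weakly pc-Grothendieck if every pseudocompact subspace of $C_p(X)$ has compact closure in $C_p(X)$; pc-Grothendieck if every pseudocompact subspace of $C_p(X)$ is compact; pe-Grothendieck if every pseudocompact subspace of $C_p(X)$ is an Eberlein compactum. A space $Z$ is a pf-space if every non-empty pseudocompact subspace $Y\subset Z$ has a point with a countable base of neighborhoods in $Y$; $X$ is pf-Grothendieck if $C_p(X)$ is a pf-space. A function $\Phi: X\times Y\to\mathbb{R}$ is separately continuous if it is continuous in each variable separately. $(X,Y)$ is a Grothendieck pair if every separately continuous $\Phi: X\times Y\to\mathbb{R}$ extends to a separately continuous function $\beta X\times Y\to\mathbb{R}$ (equivalently, for every continuous $\varphi: X\to C_p(Y)$ the closure of $\varphi(X)$ in $C_p(Y)$ is compact). $X$ and $Y$ satisfy the Namioka property $\mathcal{N}(X,Y)$ if for every separately continuous $\Phi: X\times Y\to\mathbb{R}$ there is a dense $G_\delta$ subset $D$ of $Y$ such that $\Phi$ is jointly continuous at every point of $X\times D$. $\chi(f,Y)\le\omega$ means $f$ has a countable neighborhood base in $Y$. $\pi\chi(f,Y)\le\omega$ means there is a countable family of non-empty open subsets of $Y$ such that every neighborhood of $f$ in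 $Y$ contains a member of the family. Two topologies on $Y$ coincide at $f$ if they have the same neighborhoods of $f$. *)

(* Defs.v *)
(* MathComp-Analysis, over an arbitrary [R : realType].                       *)
From HB Require Import structures.
From mathcomp Require Import all_boot all_order all_algebra.
From mathcomp Require Import all_classical all_reals topology normedtype.
From mathcomp Require Import borel_hierarchy.

Set Implicit Arguments.
Unset Strict Implicit.
Unset Printing Implicit Defensive.

Import Order.TTheory GRing.Theory Num.Theory.
Import numFieldNormedType.Exports.

Local Open Scope classical_set_scope.
Local Open Scope ring_scope.

Section Spaces.
Variable R : realType.

Definition tychonoff_space (T : topologicalType) : Prop :=
  hausdorff_space T /\ completely_regular_space T.

Definition pseudocompact (T : topologicalType) : Prop :=
  forall f : T -> R, continuous f -> bounded_fun f.

Definition homeomorphic (S T : topologicalType) : Prop :=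
  exists (f : S -> T) (g : T -> S),
    [/\ continuous f, continuous g, cancel f g & cancel g f].

Definition countable_character (T : topologicalType) (x : T) : Prop :=
  exists B : set (set T), [/\ countable B, B `<=` nbhs x &
    forall U, nbhs x U -> exists2 V, B V & V `<=` U].

Definition countable_pi_character (T : topologicalType) (x : T) : Prop :=
  exists B : set (set T), [/\ countable B,
    forall V, B V -> open V /\ V !=set0 &
    forall U, nbhs x U -> exists2 V, B V & V `<=` U].

Definition pf_space (Z : topologicalType) : Prop :=
  forall Y : set Z, Y !=set0 -> pseudocompact (set_type Y) ->
    exists y : set_type Y, countable_character y.

Section FunctionSpaces.
Variable X : topologicalType.

Definition Cp : topologicalType :=
  initial_topology (fun f : continuousType X R => (f : {ptws X -> R})).

(* Same carrier as [Cp], with the topology of uniform convergence on X. *)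
Definition Cu : topologicalType :=
  initial_topology (fun f : continuousType X R => (f : {uniform X -> R})).

Definition pointwise_uniform_coincide (Y : set Cp) (f : set_type Y) : Prop :=
  @nbhs _ (set_type (Y : set Cp)) f = @nbhs _ (set_type (Y : set Cu)) f.

End FunctionSpaces.

Definition dual_space (E : normedModType R) : Type :=
  {f : {linear E -> R^o} | continuous f}.

HB.instance Definition _ (E : normedModType R) := gen_eqMixin (dual_space E).
HB.instance Definition _ (E : normedModType R) :=
  gen_choiceMixin (dual_space E).

Definition weak_space (E : normedModType R) : topologicalType :=
  initial_topology
    (fun x : E => (fun f => sval f x) : {ptws dual_space E -> R}).

Definition eberlein_compactum (T : topologicalType) : Prop :=
  compact [set: T] /\
  exists (E : completeNormedModType R) (K : set (weak_space E)),
    compact K /\ homeomorphic T (set_type K).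

Definition weakly_pc_Grothendieck (X : topologicalType) : Prop :=
  forall Y : set (Cp X), pseudocompact (set_type Y) -> compact (closure Y).

Definition pc_Grothendieck (X : topologicalType) : Prop :=
  forall Y : set (Cp X), pseudocompact (set_type Y) -> compact Y.

Definition pe_Grothendieck (X : topologicalType) : Prop :=
  forall Y : set (Cp X),
    pseudocompact (set_type Y) -> eberlein_compactum (set_type Y).

Definition pf_Grothendieck (X : topologicalType) : Prop := pf_space (Cp X).

Section StoneCech.
Variable X : topologicalType.

Definition unit_functions : Type :=
  {f : continuousType X R | forall x, 0 <= f x <= 1}.

HB.instance Definition _ := gen_eqMixin unit_functions.
HB.instance Definition _ := gen_choiceMixin unit_functions.

Definition unit_eval (x : X) : {ptws unit_functions -> R} :=
  fun f => sval f x.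

(* The Stone-Cech compactification as the closure of the canonical image of X
   in the cube indexed by the continuous maps X -> [0, 1]; the closure is taken
   in the power of R, in which the cube is closed. *)
Definition stone_cech : topologicalType := set_type (closure (range unit_eval)).

Definition to_stone_cech (x : X) : stone_cech :=
  exist _ (unit_eval x) (mem_set (subset_closure (imageT unit_eval x))).

End StoneCech.

Definition separately_continuous (X Y : topologicalType) (Phi : X -> Y -> R)
    : Prop :=
  (forall x, continuous (Phi x)) /\ (forall y, continuous (Phi ^~ y)).

Definition Grothendieck_pair (X Y : topologicalType) : Prop :=
  forall Phi : X -> Y -> R, separately_continuous Phi ->
    exists Psi : stone_cech X -> Y -> R, separately_continuous Psi /\
      forall x y, Psi (to_stone_cech x) y = Phi x y.

Definition Namioka_property (X Y : topologicalType) : Prop :=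
  forall Phi : X -> Y -> R, separately_continuous Phi ->
    exists D : set Y, [/\ dense D, Gdelta D &
      forall x y, D y -> {for (x, y), continuous (uncurry Phi)}].

End Spaces.

(* Main.v *)
(* Conditions on a separately continuous [Phi : X -> Y -> R], for [X] and [Y]
   pseudocompact, all reduce to one property: every pointwise limit of the
   functions [Phi ^~ y] is continuous on [X].  By Grothendieck's double limit
   argument this property is symmetric in [X] and [Y].

   It implies fragmentation: otherwise a Cantor tree of open subsets of [Y]
   gives an uncountable uniformly separated family of limits of a countable set
   of functions, which form a uniformly separable set.  By Baire category, [Y]
   has a dense set of points where its pointwise and uniform topologies
   coincide.  Every limit [p] of [Y] is, by Whitley's argument, the limit of a
   sequence of such points; uniformly small neighbourhoods of these points can
   only cluster at [p], so [p] belongs to [Y] and [Y] is compact.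

   Conversely, it is enough that below every open [N <> set0] in [Y] and for
   every [x0] some open [P <> set0] and some neighbourhood [O] of [x0] make
   [Phi] oscillate little between [x0] and [O], uniformly on [P].  Joint
   continuity on [X x D], [D] dense, gives this at once; a dense set of points
   of countable pi-character gives it by Baire category and a double cluster
   point argument.

   A compact [Y] is Eberlein because, after squashing its values into ]-1, 1[,
   it embeds into the Banach space C(X) with its weak topology: limits in [Y]
   are limits of sequences, and bounded linear functionals satisfy the bounded
   convergence theorem, proved through total variation and Dini's theorem. *)
Require Import Defs.
From HB Require Import structures.
From mathcomp Require Import all_boot all_order all_algebra.
From mathcomp Require Import all_classical all_reals topology normedtype.
From mathcomp Require Import borel_hierarchy.
From mathcomp Require Import ring lra.

Set Implicit Arguments.
Unset Strict Implicit.
Unset Printing Implicit Defensive.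

Import Order.TTheory GRing.Theory Num.Theory.
Import numFieldNormedType.Exports.

Local Open Scope classical_set_scope.
Local Open Scope ring_scope.

(** * Continuous real-valued functions *)

Section RealValued.
Variables (R : realType) (T : topologicalType).
Implicit Types (f : T -> R) (c e : R).

Lemma open_dist_lt f c e : continuous f -> open [set x | `|f x - c| < e].
Proof.
move=> cf; pose A := [set r : R | `|r - c| < e].
have -> : [set x | `|f x - c| < e] = f @^-1` A by [].
apply: open_comp; first by move=> x _; exact: cf.
have -> : A = ball c e by apply/seteqP; split=> r; rewrite /A /ball /= distrC.
exact: ball_open.
Qed.

Lemma closed_dist_le f c e : continuous f -> closed [set x | `|f x - c| <= e].
Proof.
move=> cf.
have -> : [set x | `|f x - c| <= e] = (fun x => `|f x - c|) @^-1`
  [set r | r <= e].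
  by [].
apply: preimage_closed; last exact: closed_le.
move=> x _; apply: cvg_norm; apply: cvgB; [exact: cf|exact: cvg_cst].
Qed.

Lemma closed_dist_ge f c e : continuous f -> closed [set x | e <= `|f x - c|].
Proof.
move=> cf; have := open_closedC (@open_dist_lt f c e cf).
by congr (closed _); apply/seteqP; split=> x; rewrite /setC /= leNgt => /negP.
Qed.

Lemma open_dist_gt f c e : continuous f -> open [set x | e < `|f x - c|].
Proof.
move=> cf; have := closed_openC (@closed_dist_le f c e cf).
by congr (open _); apply/seteqP; split=> x; rewrite /setC /= ltNge => /negP.
Qed.

Lemma continuous_nearP f :
  (forall x e, 0 < e -> \forall y \near x, `|f y - f x| <= e) -> continuous f.
Proof.
move=> cf x; apply/cvgrPdist_le => e e0.
by apply: filterS (cf x e e0) => y; rewrite distrC.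
Qed.

Lemma continuous_sum (I : Type) (s : seq I) (g : I -> T -> R) :
  (forall i, continuous (g i)) -> continuous (fun x => \sum_(i <- s) g i x).
Proof.
move=> cg; elim: s => [|i s IH] x.
  rewrite /continuous_at big_nil; under eq_fun do rewrite big_nil.
  exact: cvg_cst.
rewrite /continuous_at big_cons; under eq_fun do rewrite big_cons.
by apply: cvgD; [exact: cg|exact: IH].
Qed.

Lemma continuous_dist_div f c e :
  continuous f -> continuous (fun x => `|f x - c| / e).
Proof.
move=> cf x; apply: cvgM; last exact: cvg_cst.
by apply: cvg_norm; apply: cvgB; [exact: cf|exact: cvg_cst].
Qed.

Lemma continuous_fmin f g : continuous f -> continuous g ->
  continuous (fun x => Num.min (f x) (g x)).
Proof. by move=> cf cg x; apply: continuous_min; [exact: cf|exact: cg]. Qed.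

Lemma continuous_fmax f g : continuous f -> continuous g ->
  continuous (fun x => Num.max (f x) (g x)).
Proof. by move=> cf cg x; apply: continuous_max; [exact: cf|exact: cg]. Qed.

Lemma continuous_fopp f : continuous f -> continuous (fun x => - f x).
Proof. by move=> cf x; apply: cvgN; exact: cf. Qed.

Lemma continuous_fadd f g : continuous f -> continuous g ->
  continuous (fun x => f x + g x).
Proof. by move=> cf cg x; apply: cvgD; [exact: cf|exact: cg]. Qed.

Lemma continuous_fsub f g : continuous f -> continuous g ->
  continuous (fun x => f x - g x).
Proof. by move=> cf cg x; apply: cvgB; [exact: cf|exact: cg]. Qed.

Lemma continuous_fcst c : continuous (fun _ : T => c).
Proof. by move=> x; exact: cvg_cst. Qed.

Lemma not_continuousP f : ~ continuous f -> exists x e, 0 < e /\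
  forall U, nbhs x U -> exists2 y, U y & e < `|f y - f x|.
Proof.
move=> ncf; apply: contrapT => H; apply: ncf; apply: continuous_nearP => x e e0.
apply: contrapT => nU; apply: H; exists x, e; split=> // U xU.
apply: contrapT => H; apply: nU; apply: filterS xU => y Uy.
by rewrite leNgt; apply/negP => le; apply: H; exists y.
Qed.

Lemma pseudocompact_bounded f : pseudocompact R T -> continuous f ->
  exists2 M, 0 < M & forall x, `|f x| <= M.
Proof.
move=> pcT cf; have [M [_ HM]] := pcT f cf.
exists (Num.max M 0 + 1); first by rewrite ltr_wpDl// le_max lexx orbT.
move=> x; apply: HM => //=; apply: (@le_lt_trans _ _ (Num.max M 0)).
  by rewrite le_max lexx.
by rewrite ltrDl.
Qed.

End RealValued.

(** * Cluster points of sequences of open sets in pseudocompact spaces *)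

Definition cluster_seq (T : topologicalType) (V : nat -> set T) (z : T) :=
  forall U, nbhs z U -> forall N, exists2 n, (N <= n)%N & V n `&` U !=set0.

Lemma cluster_seq_closed (T : topologicalType) (V : nat -> set T) z N C :
  cluster_seq V z -> closed C -> (forall n, (N <= n)%N -> V n `<=` C) -> C z.
Proof.
move=> accz clC VC; apply: clC => U /accz/(_ N)[n Nn [y [Vy Uy]]].
by exists y; split=> //; exact: (VC n).
Qed.

Section ClusterBounds.
Variables (R : realType) (T : topologicalType) (V : nat -> set T) (z : T).
Variables (f : T -> R) (c e : R) (N : nat).
Hypotheses (Vz : cluster_seq V z) (cf : continuous f).

Lemma cluster_seq_le :
  (forall n, (N <= n)%N -> forall x, V n x -> `|f x - c| <= e) ->
    `|f z - c| <= e.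
Proof. exact: (cluster_seq_closed Vz (@closed_dist_le _ _ f c e cf)). Qed.

Lemma cluster_seq_ge :
  (forall n, (N <= n)%N -> forall x, V n x -> e <= `|f x - c|) ->
    e <= `|f z - c|.
Proof. exact: (cluster_seq_closed Vz (@closed_dist_ge _ _ f c e cf)). Qed.

End ClusterBounds.

Section Pseudocompact.
Variables (R : realType) (T : topologicalType).
Hypotheses (tT : tychonoff_space T) (pcT : pseudocompact R T).

Lemma bump (x : T) U : open U -> U x -> exists g : T -> R,
  [/\ continuous g, forall y, 0 <= g y, g x = 1 & forall y, ~ U y -> g y = 0].
Proof.
move=> oU Ux; have := tT.2 x (~` U) (open_closedC oU).
move=> /(_ (fun h => h Ux)) /(@uniform_separatorP _ R)[f [cf f01 fx fU]].
exists (fun y => 1 - f y); split.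
- by move=> y; apply: cvgB; [exact: cvg_cst|exact: cf].
- move=> y; rewrite subr_ge0.
  by have /f01 : range f (f y) by []; rewrite /= in_itv => /andP[].
- by have -> : f x = 0; [apply: fx; exists x|rewrite subr0].
- by move=> y nUy; have -> : f y = 1; [apply: fU; exists y|rewrite subrr].
Qed.

(** Without a cluster point the family [V] is locally finite, so bumps of height [n] inside [V n]
    add up to an unbounded continuous function. Every later use of pseudocompactness as a weak form
    of compactness goes through this lemma. *)
Lemma pseudocompact_cluster_seq (V : nat -> set T) :
  (forall n, open (V n)) -> (forall n, V n !=set0) -> exists z, cluster_seq V z.
Proof.
move=> oV V0; apply: contrapT => nacc.
have H (z : T) : exists UN : set T * nat,
    nbhs z UN.1 /\ forall n, (UN.2 <= n)%N -> V n `&` UN.1 = set0.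
  apply: contrapT => nH; apply: nacc; exists z => U zU N.
  apply: contrapT => nE; apply: nH; exists (U, N); split=> //= n Nn.
  apply: contrapT => /eqP/set0P VU; apply: nE; exists n => //.
have [UN HUN] := choice H.
have [x Vx] := choice V0.
have [g Hg] := choice (fun n => bump (oV n) (Vx n)).
pose S N y := \sum_(n < N) n%:R * g n y.
have gV n y : ((UN y).2 <= n)%N -> g n y = 0.
  move=> Nn; have [_ _ _ gU] := Hg n; apply: gU => Vy.
  have [yU /(_ _ Nn) VU0] := HUN y.
  have : (V n `&` (UN y).1) y by split=> //; exact: nbhs_singleton.
  by rewrite VU0.
have SE N (y : T) : (forall n, (N <= n)%N -> g n y = 0) -> forall M,
  (N <= M)%N ->
    S M y = S N y.
  move=> g0 M /subnK <-; elim: (M - N)%N => [//|k IH].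
  by rewrite addSn /S big_ord_recr /= g0 ?leq_addl// mulr0 addr0 -/(S _ _) IH.
(* [F] is the infinite sum of the terms [n%:R * g n]. On the neighbourhood [(UN z).1] all terms from
   index [(UN z).2] on vanish, so there [F] equals a fixed finite sum and is continuous. *)
pose F y := S (UN y).2 y.
have FE z y : (UN z).1 y -> F y = S (UN z).2 y.
  move=> zy; rewrite /F -(SE _ y (gV^~ y) (maxn (UN y).2 (UN z).2)
    (leq_maxl _ _)).
  apply: SE; last exact: leq_maxr.
  move=> n Nn; have [_ _ _ gU] := Hg n; apply: gU => Vy.
  have [zU /(_ _ Nn) VU0] := HUN z.
  have : (V n `&` (UN z).1) y by [].
  by rewrite VU0.
have cS N : continuous (S N).
  have -> : S N = fun y => \sum_(n <- index_enum 'I_N) n%:R * g n y by [].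
  apply: continuous_sum => n y; apply: cvgM; first exact: cvg_cst.
  by have [cg _ _ _] := Hg n; exact: cg.
have cF : continuous F.
  move=> z; rewrite /continuous_at (FE z z); last first.
    by have [zU _] := HUN z; exact: nbhs_singleton.
  apply: cvg_trans (cS (UN z).2 z); apply: near_eq_cvg.
  by have [zU _] := HUN z; apply: filterS zU => y zy; rewrite (FE z y).
have [M M0 HM] := pseudocompact_bounded pcT cF.
have [n Mn] : exists n : nat, M < n%:R.
  by exists (Num.truncn M).+1; rewrite truncnS_gt.
have nN : (n < (UN (x n)).2)%N.
  rewrite ltnNge; apply/negP => Nn; have := gV n (x n) Nn.
  by have [_ _ -> _] := Hg n; apply/eqP; exact: oner_neq0.
have : n%:R <= F (x n).
  rewrite /F /S (bigD1 (Ordinal nN))//=.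
  have [_ _ -> _] := Hg n; rewrite mulr1 lerDl; apply: sumr_ge0 => i _.
  by apply: mulr_ge0 => //; have [_ g0 _ _] := Hg i.
move=> /le_trans/(_ (ler_norm _))/le_trans/(_ (HM _)).
by rewrite leNgt Mn.
Qed.

End Pseudocompact.

(** * Filters, ultrafilters and recursive choices *)

Lemma filter_forall_in (I : eqType) (T : Type) (F : set_system T) (s : seq I)
    (A : I -> set T) : Filter F ->
  (forall i, i \in s -> F (A i)) -> F [set x | forall i, i \in s -> A i x].
Proof.
move=> FF; elim: s => [|i s IH] FA; first exact: (filterS _ filterT).
have FAs := IH (fun j js => FA j (mem_behead (s := i :: s) js)).
apply: filterS (filterI (FA i (mem_head i s)) FAs) => x [Aix Asx] j.
by rewrite inE => /orP[/eqP ->//|]; exact: Asx.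
Qed.

Lemma open_forall_in (I : eqType) (T : topologicalType) (s : seq I)
    (A : I -> set T) :
  (forall i, open (A i)) -> open [set x | forall i, i \in s -> A i x].
Proof.
move=> oA; rewrite openE => x Ax; apply: filter_forall_in => i si.
by apply: open_nbhs_nbhs; split=> //; exact: Ax.
Qed.

Lemma seq_choice (A : Type) (P : seq A -> A -> Prop) :
  (forall s, exists a, P s a) ->
  exists f : nat -> A, forall n, P (mkseq f n) (f n).
Proof.
move=> /choice[g Pg]; pose l n := iter n (fun s => rcons s (g s)) [::].
have lE n : mkseq (g \o l) n = l n.
  elim: n => [//|n IH].
  by rewrite /mkseq -addn1 iotaD map_cat /= -/(mkseq _ n) IH cats1 addn1.
by exists (g \o l) => n; rewrite lE.
Qed.

Lemma mem_mkseq_nth (A : eqType) (f : nat -> A) n i :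
  (i < n)%N -> f i \in mkseq f n.
Proof. by move=> lein; apply: map_f; rewrite mem_iota. Qed.

Lemma ultra_bounded_cvg (R : realType) (I : Type) (F : set_system I)
    (u : I -> R) (M : R) : UltraFilter F -> F [set i | `|u i| <= M] ->
  exists l : R, u @ F --> l.
Proof.
move=> FU FM.
have [l [_ ll]] : `[- M, M] `&` cluster (u @ F) !=set0.
  apply: (@segment_compact R (- M) M).
  suff : F (u @^-1` `[- M, M]) by [].
  by apply: filterS FM => i /=; rewrite in_itv /= -ler_norml.
exists l => A lA; have [//|nA] := in_ultra_setVsetC (u @^-1` A) FU.
have [r [/= nAr Ar]] := ll (~` A) A nA lA.
by exfalso; exact: nAr.
Qed.

(** Plays the role of a subsequence with indices in [B]: bounded sequences converge along [F], and
    limits along [\oo] are kept. *)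
Lemma ultra_eventually (B : set nat) :
  (forall N, exists2 n, (N <= n)%N & B n) ->
  exists F : set_system nat, [/\ UltraFilter F, \oo `<=` F & F B].
Proof.
move=> infB; pose G := filter_from setT (fun N => [set n | (N <= n)%N] `&` B).
have GF : ProperFilter G.
  apply: filter_from_proper; last first.
    by move=> N _; have [n Nn Bn] := infB N; exists n.
  apply: filter_from_filter; first by exists 0%N.
  move=> M N _ _; exists (maxn M N) => // n [/=]; rewrite geq_max.
  by move=> /andP[Mn Nn] Bn; split.
have [F [FU GF']] := ultraFilterLemma GF.
exists F; split=> // [A [N _ NA]|]; apply: GF'.
  by exists N => // n [Nn _]; exact: NA.
by exists 0%N => // n [].
Qed.

Lemma harmonic_lt (R : realType) (e : R) : 0 < e ->
  exists N : nat, forall n, (N <= n)%N -> n.+1%:R^-1 < e.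
Proof.
move=> e0; exists (Num.truncn e^-1) => n Nn.
rewrite invf_plt ?posrE ?ltr0Sn//; apply: lt_le_trans (truncnS_gt _) _.
by rewrite ler_nat ltnS.
Qed.

Lemma small_eq (R : realType) (a b : R) :
  (forall e, 0 < e -> `|a - b| <= e) -> a = b.
Proof.
move=> H; apply/eqP; rewrite -subr_eq0 -normr_le0; apply/ler_addgt0Pr => e e0.
by rewrite add0r; exact: H.
Qed.

(** * Exact solutions of countable systems, and finite nets *)

Section Realize.
Variables (R : realType) (T : topologicalType).
Hypotheses (tT : tychonoff_space T) (pcT : pseudocompact R T).

(* Nonempty zero-sets of a Stone-Cech compactification meet a pseudocompact
   space; here countably many approximate equations are solved exactly. *)
Lemma pseudocompact_solve (f : nat -> T -> R) (r : nat -> R) :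
  (forall i, continuous (f i)) ->
  (forall n, exists x, forall i, (i <= n)%N -> `|f i x - r i| < n.+1%:R^-1) ->
  exists z, forall i, f i z = r i.
Proof.
move=> cf Hr.
pose V n := [set x | forall i, i \in iota 0 n.+1 -> `|f i x - r i| <
  n.+1%:R^-1].
have [z Vz] : exists z, cluster_seq V z.
  apply: (pseudocompact_cluster_seq tT pcT) => n.
    by apply: open_forall_in => i; exact: open_dist_lt.
  have [x Hx] := Hr n; exists x => i; rewrite mem_iota add0n => /andP[_].
  by rewrite ltnS; exact: Hx.
exists z => i; apply: small_eq => e /harmonic_lt[N HN].
apply: (cluster_seq_le (N := maxn i N) Vz (cf i)).
move=> n; rewrite geq_max => /andP[ni nN] x Vx; apply: ltW.
apply: lt_trans (HN n nN); apply: Vx.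
by rewrite mem_iota add0n ltnS ni.
Qed.

Lemma finite_net (I : eqType) (s : seq I) (f : I -> T -> R) e : 0 < e ->
  (forall i, continuous (f i)) ->
  exists F : seq T, forall x, exists2 t, t \in F &
    forall i, i \in s -> `|f i t - f i x| < e.
Proof.
move=> e0 cf; suff net (A : set T) : exists F : seq T,
    (forall t, t \in F -> A t) /\
    forall x, A x -> exists2 t, t \in F &
      forall i, i \in s -> `|f i t - f i x| < e.
  by have [F [_ HF]] := net setT; exists F => x; exact: HF.
elim: s A => [|i s IH] A.
  have [->|/set0P[x Ax]] := eqVneq A set0; first by exists [::].
  exists [:: x]; split=> [t|y _]; first by rewrite inE => /eqP ->.
  by exists x; rewrite ?mem_head.
have [M M0 HM] := pseudocompact_bounded pcT (cf i).
(* [c x] numbers the cell of length [e] that contains [f i x]. The net of each cell is required to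
   lie in that cell, so closeness for [f i] is automatic and the induction only treats the other
   functions. *)
pose c x := Num.truncn ((f i x + M) / e).
have fM0 x : 0 <= (f i x + M) / e.
  by apply: divr_ge0 (ltW e0); have := HM x; rewrite ler_norml => /andP[]; lra.
have c_lt x : (c x < (Num.truncn (2 * M / e)).+1)%N.
  rewrite ltnS; apply: le_truncn; rewrite ler_pM2r ?invr_gt0//.
  by have := HM x; rewrite ler_norml => /andP[_]; lra.
have [F HF] := choice (fun n => IH [set x | A x /\ c x = n]).
exists (flatten [seq F n | n <- iota 0 (Num.truncn (2 * M / e)).+1]); split.
  by move=> t /flatten_mapP[n _ tF]; have [/(_ t tF)[]] := HF n.
move=> x Ax; have [FA /(_ x (conj Ax erefl))[t tF Ht]] := HF (c x).
exists t => [|j].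
  by apply/flatten_mapP; exists (c x) => //; rewrite mem_iota add0n c_lt.
rewrite inE => /orP[/eqP ->|]; last exact: Ht.
have [_ ctx] := FA t tF.
have /truncn_itv/andP[t1 t2] := fM0 t; have /truncn_itv/andP[x1 x2] := fM0 x.
rewrite -/(c t) ctx in t1 t2; rewrite -/(c x) in x1 x2.
rewrite ler_pdivlMr// in t1; rewrite ltr_pdivrMr// in t2.
rewrite ler_pdivlMr// in x1; rewrite ltr_pdivrMr// in x2.
rewrite -natr1 in t2 x2; rewrite ltr_norml; apply/andP; split; nra.
Qed.
End Realize.

(** * Pointwise limits of families of functions *)

(* [h] lies in the closure of [{Phi ^~ y | y in D}] in the full power of [R]. *)
Definition pointwise_limit (R : realType) (Z : eqType) (Y : Type)
    (Phi : Z -> Y -> R) (D : set Y) (h : Z -> R) :=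
  forall (s : seq Z) (e : R), 0 < e ->
    exists2 y, D y & forall x, x \in s -> `|Phi x y - h x| < e.

Definition continuous_limits (R : realType) (X : topologicalType) (Y : Type)
    (Phi : X -> Y -> R) :=
  forall h, pointwise_limit Phi setT h -> continuous h.

Section Limits.
Variables (R : realType) (X : eqType) (Y : Type) (Phi : X -> Y -> R).

Lemma pointwise_limitS (A B : set Y) h :
  A `<=` B -> pointwise_limit Phi A h -> pointwise_limit Phi B h.
Proof. by move=> AB hA s e e0; have [y /AB By Hy] := hA s e e0; exists y. Qed.

Lemma cvg_pointwise_limit (I : Type) (F : set_system I) (y : I -> Y)
    (D : set Y) h :
  ProperFilter F -> F (y @^-1` D) ->
  (forall x, Phi x (y i) @[i --> F] --> h x) ->
  pointwise_limit Phi D h.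
Proof.
move=> FF FD Fh s e e0.
have Fs : F [set i | forall x, x \in s -> `|Phi x (y i) - h x| < e].
  by apply: filter_forall_in => x _; move/cvgrPdistC_lt: (Fh x); apply.
by have [i [Di Hi]] := filter_ex (filterI FD Fs); exists (y i).
Qed.

Lemma pointwise_limit_ultra (D : set Y) h : pointwise_limit Phi D h ->
  exists F : set_system Y, [/\ UltraFilter F, F D &
    forall x, Phi x y @[y --> F] --> h x].
Proof.
move=> hD.
pose G := filter_from [set se : seq X * R | 0 < se.2]
  (fun se => D `&` [set y | forall x, x \in se.1 -> `|Phi x y - h x| < se.2]).
have GF : ProperFilter G.
  apply: filter_from_proper; last first.
    by move=> [s e] /= e0; have [y Dy Hy] := hD s e e0; exists y.
  apply: filter_from_filter; first by exists ([::], 1) => /=.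
  move=> [s1 e1] [s2 e2] /= e10 e20.
  exists (s1 ++ s2, Num.min e1 e2) => /=; first by rewrite lt_min e10.
  move=> y [Dy Hy]; split; split=> // x xs.
    have := Hy x; rewrite mem_cat xs => /(_ isT).
    by rewrite lt_min => /andP[].
  have := Hy x; rewrite mem_cat xs orbT => /(_ isT).
  by rewrite lt_min => /andP[].
have [F [FU GF']] := ultraFilterLemma GF; exists F; split=> // [|x].
  by apply: GF'; exists ([::], 1) => //= y [].
apply/cvgrPdistC_lt => e e0; apply: GF'; exists ([:: x], e) => //= y [_]; apply.
exact: mem_head.
Qed.

Lemma ultra_pointwise_cvg (I : Type) (F : set_system I) (y : I -> Y) :
  UltraFilter F -> (forall x, exists M, F [set i | `|Phi x (y i)| <= M]) ->
  exists h : X -> R, forall x, Phi x (y i) @[i --> F] --> h x.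
Proof.
move=> FU bnd; have H x : exists l : R, Phi x (y i) @[i --> F] --> l.
  by have [M HM] := bnd x; exact: ultra_bounded_cvg HM.
by have [h Hh] := choice H; exists h.
Qed.

Lemma cvg_unique_eventually (u : nat -> R) (F : set_system nat) (a b : R) :
  UltraFilter F -> \oo `<=` F -> u @ F --> a -> u @ \oo --> b -> a = b.
Proof.
move=> FU oF ua ub; apply: (cvg_unique _ ua) => //.
exact: cvg_trans (cvg_app u oF) ub.
Qed.

End Limits.

Lemma cvg_harmonic (R : realType) (u : nat -> R) (b : R) N :
  (forall n, (N <= n)%N -> `|u n - b| < n.+1%:R^-1) -> u @ \oo --> b.
Proof.
move=> H; apply/cvgrPdistC_lt => e /harmonic_lt[M HM].
exists (maxn N M) => // n /=; rewrite geq_max => /andP[Nn Mn].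
exact: lt_trans (H n Nn) (HM n Mn).
Qed.

(** * Double limits, convergent sequences and uniform control of limits *)

Section Grothendieck.
Variables (R : realType) (X Y : topologicalType) (Phi : X -> Y -> R).
Hypotheses (tX : tychonoff_space X) (pcX : pseudocompact R X).
Hypothesis sPhi : separately_continuous Phi.

Let cX y : continuous (Phi ^~ y). Proof. exact: sPhi.2. Qed.
Let cY x : continuous (Phi x). Proof. exact: sPhi.1. Qed.

(* Grothendieck's double limit argument. *)
Lemma continuous_limits_sym : (forall x, exists M, forall y, `|Phi x y| <= M) ->
  continuous_limits Phi -> continuous_limits (fun y x => Phi x y).
Proof.
move=> bnd limC k hk; apply: contrapT => /not_continuousP[y0 [e [e0 He]]].
(* The next pair is chosen with [y] close to [y0] as seen from the earlier [x], although [k y] is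
   far from [k y0]; then [x] is chosen so that [Phi x] is close to [k] at [y0], at the earlier [y]
   and at the new one. *)
pose P (s : seq (X * Y)) (a : X * Y) := [/\
  forall b, b \in s -> `|Phi b.1 a.2 - Phi b.1 y0| < (size s).+1%:R^-1,
  e < `|k a.2 - k y0|,
  forall b, b \in s -> `|Phi a.1 b.2 - k b.2| < (size s).+1%:R^-1,
  `|Phi a.1 a.2 - k a.2| < (size s).+1%:R^-1 &
  `|Phi a.1 y0 - k y0| < (size s).+1%:R^-1].
have [a Pa] : exists f : nat -> X * Y, forall n, P (mkseq f n) (f n).
  apply: seq_choice => s; have n0 : 0 < (size s).+1%:R^-1 :> R
    by rewrite invr_gt0.
  have Hs : nbhs y0 [set y | forall b, b \in s ->
      `|Phi b.1 y - Phi b.1 y0| < (size s).+1%:R^-1].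
    apply: filter_forall_in => b _; apply: open_nbhs_nbhs; split.
      by apply: open_dist_lt; exact: cY.
    by rewrite /= subrr normr0.
  have [y Hy ky] := He _ Hs.
  have [x _ Hx] := hk (y :: y0 :: [seq b.2 | b <- s]) _ n0.
  exists (x, y); split=> //=.
  - by move=> b bs; apply: Hx; rewrite !inE map_f ?orbT.
  - by apply: Hx; rewrite mem_head.
  - by apply: Hx; rewrite !inE eqxx orbT.
pose x n := (a n).1; pose y n := (a n).2.
have a1 i n : (i < n)%N -> `|Phi (x i) (y n) - Phi (x i) y0| < n.+1%:R^-1.
  move=> lein; have [+ _ _ _ _] := Pa n; rewrite size_mkseq; apply.
  exact: mem_mkseq_nth.
have a2 n : e < `|k (y n) - k y0| by have [] := Pa n.
have a3 i n : (i <= n)%N -> `|Phi (x n) (y i) - k (y i)| < n.+1%:R^-1.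
  have [_ _ + + _] := Pa n; rewrite size_mkseq leq_eqVlt => H1 H2.
  by move=> /orP[/eqP -> //|lein]; apply: H1; exact: mem_mkseq_nth.
have a4 n : `|Phi (x n) y0 - k y0| < n.+1%:R^-1.
  by have [_ _ _ _ +] := Pa n; rewrite size_mkseq.
have [F [FU oF _]] := @ultra_eventually setT (fun N => ex_intro2 _ _ N
  (leqnn N) I).
have [h Fh] : exists h : X -> R, forall x, Phi x (y i) @[i --> F] --> h x.
  apply: ultra_pointwise_cvg => x'; have [M HM] := bnd x'.
  by exists M; apply: filterS filterT => i _; exact: HM.
have ch : continuous h.
  by apply: limC; apply: (cvg_pointwise_limit (y := y)) Fh => //;
    exact: filterT.
have hx n : h (x n) = Phi (x n) y0.
  apply: (cvg_unique_eventually FU oF (Fh _)).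
  by apply: (@cvg_harmonic _ _ _ n.+1) => m; exact: a1.
(* The system asks for [h z = k y0] and [Phi z (y j) = k (y j)] for all [j]; the points [x n] solve
   it approximately. Its exact solution forces [k (y j)] to tend to [h z = k y0] along [F], against
   the choice of [y]. *)
pose f i := if i is j.+1 then Phi ^~ (y j) else h.
pose r i := if i is j.+1 then k (y j) else k y0.
have cf i : continuous (f i) by case: i => [|j] /=; [exact: ch|exact: cX].
have [z Hz] : exists z, forall i, f i z = r i.
  apply: (pseudocompact_solve tX pcX) => // n.
  exists (x n) => -[|j] jn /=; first by rewrite hx.
  by apply: a3; exact: ltnW.
have : (fun i => k (y i)) @ F --> k y0.
  rewrite -[k y0](Hz 0%N) /=; apply: cvg_trans (Fh z).
  by apply: near_eq_cvg; apply: filterE => i; have /= -> := Hz i.+1.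
move/cvgrPdistC_lt => /(_ e e0)/filter_ex[n /=].
by rewrite ltNge (ltW (a2 n)).
Qed.

(* Whitley's construction: a sequence close to [p] on finite nets for the
   previous terms can only accumulate at [p]. *)
Lemma pointwise_limit_seq (D : set Y) (p : X -> R) :
  (forall x, exists M, forall y, D y -> `|Phi x y| <= M) ->
  (forall h, pointwise_limit Phi D h -> continuous h) ->
  pointwise_limit Phi D p ->
  exists2 y : nat -> Y, forall n, D (y n) &
    forall x, Phi x (y n) @[n --> \oo] --> p x.
Proof.
move=> bnd limC hp; have cp := limC p hp.
(* [None] stands for the limit [p], so that one finite net serves [p] and the earlier terms
   together. *)
pose g (o : option Y) x := if o is Some y then Phi x y else p x.
have cg o : continuous (g o) by case: o => [y|] /=; [exact: cX|exact: cp].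
have [net Hnet] : {net : seq Y -> seq X & forall s x, exists2 t, t \in net s &
    forall o, o \in None :: map Some s -> `|g o t - g o x| < (size s).+1%:R^-1}.
  apply: (@choice _ _ (fun (s : seq Y) net => forall x, exists2 t, t \in net &
    forall o, o \in None :: map Some s -> `|g o t - g o x| <
      (size s).+1%:R^-1)) => s.
  by apply: (finite_net pcX) => //; rewrite invr_gt0.
have [y Hy] : exists y : nat -> Y, forall n, D (y n) /\
    forall m, (m <= n)%N -> forall t, t \in net (mkseq y m) ->
    `|Phi t (y n) - p t| < n.+1%:R^-1.
  pose P s y := D y /\ forall m, (m <= size s)%N -> forall t,
    t \in net (take m s) ->
    `|Phi t y - p t| < (size s).+1%:R^-1.
  have [y Py] : exists y : nat -> Y, forall n, P (mkseq y n) (y n).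
    apply: seq_choice => s; have n0 : 0 < (size s).+1%:R^-1 :> R
      by rewrite invr_gt0.
    have [y Dy Hy] := hp (flatten [seq net (take m s) | m <- iota 0
      (size s).+1]) _ n0.
    exists y; split=> // m ms t tm; apply: Hy; apply/flatten_mapP;
      exists m => //.
    by rewrite mem_iota add0n ltnS ms.
  exists y => n; have [Dy] := Py n; rewrite size_mkseq => H; split=> // m mn t
    tm.
  by apply: (H m mn); rewrite /mkseq -map_take take_iota (minn_idPl mn).
exists y => [n|x]; first by have [] := Hy n.
apply: contrapT => /cvgrPdistC_lt nc.
have [e e0 He] : exists2 e, 0 < e & ~ \forall n \near \oo, `|Phi x (y n) - p
  x| < e.
  by apply: contrapT => H; apply: nc => e e0; apply: contrapT => H'; apply: H;
    exists e.
(* If convergence fails at [x], [F] concentrates on the bad indices. The limit [h] along [F] agrees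
   with [p] on every net. *)
have [F [FU oF Fe]] : exists F : set_system nat, [/\ UltraFilter F, \oo `<=` F &
    F [set n | e <= `|Phi x (y n) - p x|]].
  apply: ultra_eventually => N; apply: contrapT => H; apply: He;
    exists N => // n Nn.
  by rewrite /= ltNge; apply/negP => le; apply: H; exists n.
have [h Fh] : exists h : X -> R, forall x, Phi x (y i) @[i --> F] --> h x.
  apply: ultra_pointwise_cvg => x'; have [M HM] := bnd x'.
  by exists M; apply: filterS filterT => i _; apply: HM; have [] := Hy i.
have ch : continuous h.
  apply: limC; apply: (cvg_pointwise_limit (y := y)) Fh.
  by apply: filterS filterT => n _; have [] := Hy n.
have hnet n t : t \in net (mkseq y n) -> h t = p t.
  move=> tn; apply: (cvg_unique_eventually FU oF (Fh t)).
  by apply: (@cvg_harmonic _ _ _ n) => m nm; have [_ /(_ n nm t tn)] := Hy m.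
(* Net points near [x] solve approximately [h z = p x] and [Phi z (y j) = Phi x (y j)]. The exact
   solution [z] is not distinguished from [x] by any [y j], hence not by [h], which gives
   [h x = p x]. *)
pose f i := if i is j.+1 then Phi ^~ (y j) else h.
pose r i := if i is j.+1 then Phi x (y j) else p x.
have cf i : continuous (f i) by case: i => [|j] /=; [exact: ch|exact: cX].
have [z Hz] : exists z, forall i, f i z = r i.
  apply: (pseudocompact_solve tX pcX) => // n.
  have [t tn] := Hnet (mkseq y n) x; rewrite size_mkseq => Ht.
  exists t => -[|j] jn /=.
    by rewrite (hnet n)//; apply: (Ht None); rewrite mem_head.
  by apply: (Ht (Some (y j))); rewrite inE map_f//; exact: mem_mkseq_nth.
have hx : h x = p x.
  rewrite -[RHS](Hz 0%N) /=; apply: (cvg_unique _ (Fh x)) => //.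
  apply: cvg_trans (Fh z).
  by apply: near_eq_cvg; apply: filterE => i; have /= -> := Hz i.+1.
have /cvgrPdistC_lt/(_ e e0) := Fh x; rewrite hx => Fe'.
by have [n [/= + /=]] := filter_ex (filterI Fe Fe'); rewrite leNgt => /negP.
Qed.

(** Otherwise there are pairs of points that agree better and better on the [q i] while [h] differs
    by more than [d]. Limits of their values along an ultrafilter are attained at points [z] and
    [z'] that agree on all [q i], hence on [h]. Consequently the values of [h] on a finite net
    determine it up to a small uniform error. *)
Lemma pointwise_limit_unif (q : nat -> Y) h d : 0 < d ->
  (forall h, pointwise_limit Phi (range q) h -> continuous h) ->
  pointwise_limit Phi (range q) h ->
  exists N, forall x x',
    (forall i, (i <= N)%N -> `|Phi x (q i) - Phi x' (q i)| < N.+1%:R^-1) ->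
    `|h x - h x'| <= d.
Proof.
move=> d0 limC hh; have ch := limC h hh; apply: contrapT => H.
have Hn n : exists x : X * X, (forall i, (i <= n)%N ->
    `|Phi x.1 (q i) - Phi x.2 (q i)| < n.+1%:R^-1) /\ d < `|h x.1 - h x.2|.
  apply: contrapT => Hn; apply: H; exists n => x x' Hx.
  by rewrite leNgt; apply/negP => lt; apply: Hn; exists (x, x').
have {Hn H} [x Hx] := choice Hn.
have [F [FU oF _]] := @ultra_eventually setT (fun N => ex_intro2 _ _ N
  (leqnn N) I).
pose f i := if i is j.+1 then Phi ^~ (q j) else h.
have cf i : continuous (f i) by case: i => [|j] /=; [exact: ch|exact: cX].
have lim (a : nat -> X) : exists r : nat -> R, forall i, f i (a n) @[n --> F]
  --> r i.
  have H i : exists l : R, f i (a n) @[n --> F] --> l.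
    have [M _ HM] := pseudocompact_bounded pcX (cf i).
    by apply: (ultra_bounded_cvg (M := M)); apply: filterS filterT => n _;
      exact: HM.
  by have [r Hr] := choice H; exists r.
have solve (a : nat -> X) (r : nat -> R) : (forall i, f i (a n) @[n --> F] -->
  r i) ->
    exists z, forall i, f i z = r i.
  move=> Fr; apply: (pseudocompact_solve tX pcX) => // n.
  have Fn : F [set m | forall i, i \in iota 0 n.+1 -> `|f i (a m) - r i| <
    n.+1%:R^-1].
    apply: filter_forall_in => i _; move/cvgrPdistC_lt: (Fr i); apply.
    by rewrite invr_gt0.
  have [m Hm] := filter_ex Fn; exists (a m) => i ilen; apply: Hm.
  by rewrite mem_iota add0n ltnS ilen.
have [r Fr] := lim (fun n => (x n).1); have [z Hz] := solve _ _ Fr.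
have [r' Fr'] := lim (fun n => (x n).2); have [z' Hz'] := solve _ _ Fr'.
have rr' i : r i.+1 = r' i.+1.
  have Fd : (fun n => Phi (x n).1 (q i) - Phi (x n).2 (q i)) @ F -->
    r i.+1 - r' i.+1.
    by apply: cvgB; [exact: (Fr i.+1)|exact: (Fr' i.+1)].
  apply/eqP; rewrite -subr_eq0; apply/eqP; apply: (cvg_unique_eventually FU oF
    Fd).
  apply: (@cvg_harmonic _ _ _ i) => n ilen; rewrite subr0.
  by have [/(_ i ilen)] := Hx n.
have hz : h z = h z'.
  apply: small_eq => e e0; have e20 : 0 < e / 2 by apply: divr_gt0.
  have [_ [i _ <-] Hi] := hh [:: z; z'] _ e20.
  have H1 := Hi z; have H2 := Hi z'; rewrite !inE !eqxx ?orbT in H1 H2.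
  have := Hz i.+1; have := Hz' i.+1; rewrite -rr' /= => <- E.
  rewrite E in H1.
  rewrite (_ : _ - _ = (Phi z' (q i) - h z') - (Phi z' (q i) - h z));
    last by ring.
  apply: le_trans (ler_normB _ _) _.
  by apply: ltW; rewrite [ltRHS]splitr ltrD// ?H1 ?H2.
have : F [set n | `|h (x n).1 - r 0%N| < d / 2 /\ `|h (x n).2 - r' 0%N| < d /
  2].
  have d20 : 0 < d / 2 by apply: divr_gt0.
  by apply: filterI; [move/cvgrPdistC_lt: (Fr 0%N); apply|
    move/cvgrPdistC_lt: (Fr' 0%N); apply].
move=> /filter_ex[n [H1 H2]]; have [_] := Hx n.
have /= E := Hz 0%N; have /= E' := Hz' 0%N.
rewrite -E in H1; rewrite -E' -hz in H2; apply/negP; rewrite -leNgt.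
rewrite (_ : _ - _ = (h (x n).1 - h z) - (h (x n).2 - h z)); last by ring.
by apply: le_trans (ler_normB _ _) _; apply: ltW; rewrite [ltRHS]splitr ltrD.
Qed.

End Grothendieck.

(** * Dependent choice, Cantor's diagonal and Baire category *)

Lemma iterate_choice (A : Type) (Inv : A -> Prop) (Rel : A -> A -> Prop) a0 :
  Inv a0 -> (forall a, Inv a -> exists2 b, Inv b & Rel a b) ->
  exists f : nat -> A, [/\ f 0%N = a0, forall n, Inv (f n) &
    forall n, Rel (f n) (f n.+1)].
Proof.
move=> Inv0 step.
have H a : exists b, Inv a -> Inv b /\ Rel a b.
  have [ia|na] := pselect (Inv a); last by exists a.
  by have [b ib ab] := step a ia; exists b.
have [g Hg] := choice H; pose f n := iter n g a0.
have If n : Inv (f n) by elim: n => [//|n IH]; have [] := Hg _ IH.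
by exists f; split=> // n; have [] := Hg _ (If n).
Qed.

(** Decoding natural numbers through [c] would enumerate all binary sequences by [g]; the diagonal
    sequence [d] is then missed. *)
Lemma no_countable_cantor (C : countType) (c : (nat -> bool) -> C) :
  ~ injective c.
Proof.
move=> injc; pose g n : nat -> bool :=
  if pselect (exists s, pickle (c s) = n) is left H then projT1 (cid H) else
    xpredT.
have gc s : g (pickle (c s)) = s.
  rewrite /g; case: pselect => [H|[]]; last by exists s.
  by apply: injc; apply: (pcan_inj pickleK); exact: projT2 (cid H).
pose d n := ~~ g n n; have := congr1 (@^~ (pickle (c d))) (gc d).
by rewrite /= {3}/d; case: (g _ _).
Qed.

Section Baire.
Variables (R : realType) (T : topologicalType).
Hypotheses (tT : tychonoff_space T) (pcT : pseudocompact R T).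

(** By regularity one builds nonempty open sets, each with its closure inside the previous one and
    inside the next [U n]. A cluster point of this sequence lies in all the closures. *)
Lemma pseudocompact_baire (V0 : set T) (U : nat -> set T) :
  open V0 -> V0 !=set0 -> (forall n, open (U n)) ->
  (forall n V, open V -> V !=set0 -> V `<=` V0 -> V `&` U n !=set0) ->
  exists2 z, V0 z & forall n, U n z.
Proof.
move=> oV0 V00 oU dU.
have rT := completely_regular_regular (R := R) tT.2.
pose Inv (a : nat * set T) := [/\ open a.2, a.2 !=set0 & a.2 `<=` V0].
pose Rel (a b : nat * set T) := b.1 = a.1.+1 /\ closure b.2 `<=` a.2 `&` U a.1.
have [f [f0 If Rf]] : exists f : nat -> nat * set T, [/\ f 0%N = (0%N, V0),
    forall n, Inv (f n) & forall n, Rel (f n) (f n.+1)].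
  apply: iterate_choice; first by split.
  move=> [n V] [/= oV V0' VV0]; have [z [Vz Uz]] := dU n V oV V0' VV0.
  have [W zW WV] := rT z (V `&` U n) (open_nbhs_nbhs (conj (openI oV (oU n))
    (conj Vz Uz))).
  exists (n.+1, W°); split=> //=.
  - exact: open_interior.
  - by exists z; exact: zW.
  - by move=> x /interior_subset/subset_closure/WV[/VV0].
  - by move=> x Wx; apply: WV; apply: closureS Wx; exact: interior_subset.
have f1 n : (f n).1 = n.
  by elim: n => [|n IH]; [rewrite f0|have [-> _] := Rf n; rewrite IH].
have fS m n : (m <= n)%N -> (f n).2 `<=` (f m).2.
  move=> /subnK <-; elim: (n - m)%N => [//|k IH] x.
  by rewrite addSn => /subset_closure; have [_ H] := Rf (k + m)%N => /H[/IH].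
have [z Vz] : exists z, cluster_seq (fun n => (f n).2) z.
  by apply: (pseudocompact_cluster_seq tT pcT) => n; have [] := If n.
have clz n : closure (f n).2 z.
  apply: (cluster_seq_closed (N := n) Vz); first exact: closed_closure.
  by move=> m nm x /(fS _ _ nm)/subset_closure.
exists z => [|n].
  by have [_ /(_ z (clz 1%N))[+ _]] := Rf 0%N; rewrite f0.
by have [_ /(_ z (clz n.+1))[_]] := Rf n; rewrite f1.
Qed.

Lemma pseudocompact_dense_bigcap (U : nat -> set T) :
  (forall n, open (U n)) -> (forall n, dense (U n)) -> dense (\bigcap_n U n).
Proof.
move=> oU dU O O0 oO; have [z Oz Uz] : exists2 z, O z & forall n, U n z.
  by apply: pseudocompact_baire => // n V oV V0 _; exact: dU.
by exists z; split=> // n _; exact: Uz.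
Qed.

Lemma pseudocompact_baire_cover (V0 : set T) (F : nat -> set T) :
  open V0 -> V0 !=set0 -> (forall n, closed (F n)) -> V0 `<=` \bigcup_n F n ->
  exists n V, [/\ open V, V !=set0 & V `<=` V0 `&` F n].
Proof.
move=> oV0 V00 clF cov; apply: contrapT => H.
have [z V0z Uz] : exists2 z, V0 z & forall n, (~` F n) z.
  apply: pseudocompact_baire => // [n|n V oV V0' VV0];
    first exact: closed_openC.
  apply: contrapT => VF; apply: H; exists n, V; split=> // x Vx; split;
    first exact: VV0.
  by apply: contrapT => nFx; apply: VF; exists x.
by have [n _ Fz] := cov z V0z; exact: (Uz n).
Qed.

End Baire.

(** * Fragmentation by the uniform distance *)

Section Fragmentation.
Variables (R : realType) (X Y : topologicalType) (Phi : X -> Y -> R).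
Hypotheses (tX : tychonoff_space X) (pcX : pseudocompact R X).
Hypothesis sPhi : separately_continuous Phi.
Hypothesis bnd : forall x, exists M, forall y, `|Phi x y| <= M.
Hypothesis limC : continuous_limits Phi.

Let cX y : continuous (Phi ^~ y). Proof. exact: sPhi.2. Qed.
Let cY x : continuous (Phi x). Proof. exact: sPhi.1. Qed.

(* Otherwise a Cantor tree of open sets produces, in the closure of a countable
   subfamily, continuum many limits that are uniformly far apart; but each of
   them is coded, up to a small uniform error, by finitely many integers. *)
Lemma fragmentation (W0 : set Y) (e : R) : 0 < e -> open W0 -> W0 !=set0 ->
  exists W, [/\ open W, W !=set0, W `<=` W0 &
    forall x w w', W w -> W w' -> `|Phi x w - Phi x w'| <= e].
Proof.
move=> e0 oW0 W00; apply: contrapT => bad.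
pose Inv (W : set Y) := [/\ open W, W !=set0 & W `<=` W0].
have split_W (W : set Y) : exists a : X * (bool -> set Y), Inv W ->
    [/\ forall b, Inv (a.2 b), forall b, a.2 b `<=` W &
      forall w w', a.2 true w -> a.2 false w' -> e / 2 <= Phi a.1 w - Phi a.1
        w'].
  (* Outside the invariant any value will do; [X] has a point, since over an empty [X] the set [W0]
     itself would satisfy the conclusion. *)
  have [[oW Wn0 WW0]|nI] := pselect (Inv W); last first.
    have [y0 _] := W00; have [x] : exists x : X, True.
      apply: contrapT => nX; apply: bad; exists W0; split=> // x.
      by exfalso; apply: nX; exists x.
    by exists (x, fun=> set0).
  have [x [w [w' [Ww Ww' eww]]]] : exists x w w', [/\ W w, W w' & e < Phi x w -
    Phi x w'].
    apply: contrapT => nx; apply: bad; exists W; split=> // x w w' Ww Ww'.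
    rewrite leNgt; apply/negP; rewrite ltr_normr => /orP[lt|lt]; apply: nx.
      by exists x, w, w'.
    by exists x, w', w; split=> //; rewrite -opprB.
  (* The two values are more than [e] apart, and a tolerance of [e / 4] around each leaves a gap of
     [e / 2]. *)
  pose c b := if b then w else w'.
  exists (x, fun b => W `&` [set y | `|Phi x y - Phi x (c b)| < e / 4]) => _;
    split=> /=.
  - move=> b; split; [|exists (c b); split|by move=> y [/WW0]].
    + by apply: openI => //; apply: open_dist_lt; exact: cY.
    + by case: b.
    + by rewrite /= subrr normr0 divr_gt0.
  - by move=> b y [].
  - move=> y y' [_ /=]; rewrite ltr_distl => /andP[y1 y2].
    by move=> [_ /=]; rewrite ltr_distl => /andP[y'1 y'2]; lra.
have [a Ha] := choice split_W.
pose node := foldr (fun b W => (a W).2 b) W0.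
have Inode s : Inv (node s).
  by elim: s => [|b s IH] /=; [split|have [+ _ _] := Ha _ IH; apply].
have node_sub b s : node (b :: s) `<=` node s.
  by have [_ + _] := Ha _ (Inode s); apply.
have [q nq] : {q : seq bool -> Y & forall s, node s (q s)}.
  by apply: choice => s; have [_ + _] := Inode s.
pose qn n := q (odflt [::] (unpickle n)).
have qnE s : qn (pickle s) = q s by rewrite /qn pickleK.
(* A child of the node [s] is [b :: s], so the most recent choice stands first and a branch has to
   be reversed. *)
pose path (s : nat -> bool) n := rev (mkseq s n).
have pathS s n : path s n.+1 = s n :: path s n.
  by rewrite /path /mkseq -addn1 iotaD map_cat rev_cat.
have path_sub s m n : (m <= n)%N -> node (path s n) `<=` node (path s m).
  move=> /subnK <-; elim: (n - m)%N => [//|k IH] y.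
  by rewrite addSn pathS => /node_sub/IH.
have [F [FU oF _]] := @ultra_eventually setT (fun N => ex_intro2 _ _ N
  (leqnn N) I).
have lim s : exists h : X -> R, forall x, Phi x (q (path s n)) @[n --> F] -->
  h x.
  apply: (ultra_pointwise_cvg (y := fun n => q (path s n))) => x.
  by have [M HM] := bnd x; exists M; apply: filterS filterT => n _; exact: HM.
have [h Fh] := choice lim.
have limq g : pointwise_limit Phi (range qn) g -> continuous g.
  by move=> Hg; apply: limC; exact: pointwise_limitS Hg.
have hq s : pointwise_limit Phi (range qn) (h s).
  apply: (cvg_pointwise_limit (y := fun n => q (path s n))) (Fh s).
  by apply: filterS filterT => n _ /=; rewrite -qnE; exists (pickle (path s n)).
have far s t : s <> t -> exists x, e / 2 <= `|h s x - h t x|.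
  move=> st; have st' : exists n, s n != t n.
    apply: contrapT => H; apply: st; apply/funext => n.
    by apply/eqP; apply: contrapT => /negP nst; apply: H; exists n.
  pose n := ex_minn st'; have [stn mn] : s n != t n /\ forall m, (m < n)%N ->
    s m = t m.
    rewrite /n; case: ex_minnP => m stm minm; split=> // k km.
    by apply/eqP; apply: contraLR km => /minm; rewrite -leqNgt.
  have pst : path s n = path t n.
    rewrite /path; congr rev; apply/eq_in_map => m; rewrite mem_iota add0n =>
      mn'.
    exact: mn.
  exists (a (node (path s n))).1; set x := (a _).1.
  have [_ _ sep] := Ha _ (Inode (path s n)).
  have key (u v : nat -> bool) : u n -> ~~ v n -> path u n = path s n ->
    path v n = path s n ->
      e / 2 <= `|h u x - h v x|.
    move=> un vn pu pv; apply: le_trans (ler_norm _).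
    have Fd : (fun m => Phi x (q (path u m)) - Phi x (q (path v m))) @ F -->
      h u x - h v x.
      by apply: cvgB; exact: Fh.
    rewrite leNgt; apply/negP => lt.
    have d0 : 0 < e / 2 - (h u x - h v x) by rewrite subr_gt0.
    have /cvgrPdistC_lt/(_ _ d0) F1 := Fd.
    have F2 : F [set m | (n < m)%N] by apply: oF; exists n.+1.
    have [m [/= nm]] := filter_ex (filterI F2 F1).
    rewrite ltNge => /negP; apply; apply: le_trans (ler_norm _).
    rewrite lerD2r; apply: sep.
      by have := path_sub u _ _ nm _ (nq (path u m)); rewrite pathS pu un.
    by have := path_sub v _ _ nm _ (nq (path v m)); rewrite pathS pv
      (negbTE vn).
  case sn : (s n); case tn : (t n); move: stn; rewrite sn tn // => _.
    by apply: key; rewrite ?sn ?tn.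
  by rewrite distrC; apply: key; rewrite ?sn ?tn.
(* Equal codes give an error [d] for each passage between [x] and the net and one more [d] from
   rounding: [3 * d < e / 2]. *)
pose d := e / 8; have d0 : 0 < d by apply: divr_gt0.
have [N HN] := choice (fun s => pointwise_limit_unif tX pcX sPhi d0 limq
  (hq s)).
have nets n : exists L : seq X, forall x, exists2 t, t \in L &
    forall i, i \in iota 0 n.+1 -> `|Phi t (qn i) - Phi x (qn i)| < n.+1%:R^-1.
  by apply: (finite_net pcX) => [|i]; [rewrite invr_gt0|exact: cX].
have [L HL] := choice nets.
(* The code records the precision needed for [h s] and its values on the corresponding net, rounded
   to multiples of [d]. *)
pose c s := (N s, [seq Num.floor (h s t / d) | t <- L (N s)]).
apply: (@no_countable_cantor _ c) => s t.
case=> Nst; rewrite /c -Nst => fl; apply: contrapT => /far[x].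
have [t0 tL Ht] := HL (N s) x.
have near u : N u = N s -> `|h u t0 - h u x| <= d.
  move=> Nu; apply: HN => i iN; rewrite Nu; apply: Ht.
  by rewrite mem_iota add0n ltnS -Nu.
have := near s erefl; have := near t (esym Nst).
have /eq_in_map/(_ t0 tL) E := fl.
have dd : `|h s t0 - h t t0| <= d.
  have := floor_le (h s t0 / d); have := floorD1_gt (h s t0 / d).
  have := floor_le (h t t0 / d); have := floorD1_gt (h t t0 / d).
  rewrite E; set k := _%:~R => h1 h2 h3 h4.
  rewrite ler_pdivlMr// in h2; rewrite ler_pdivlMr// in h4.
  rewrite ltr_pdivrMr// in h1; rewrite ltr_pdivrMr// in h3.
  by rewrite ler_norml; apply/andP; split; nra.
move: dd; rewrite !ler_norml => /andP[A1 A2] /andP[B1 B2] /andP[C1 C2].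
by rewrite leNgt => /negP; apply; rewrite ltr_norml; apply/andP;
  rewrite /d in A1 A2 B1 B2 C1 C2; split; lra.
Qed.

End Fragmentation.

(** * From local joint control to continuity of limits, and back to generic continuity *)

Definition locally_joint (R : realType) (X Y : topologicalType)
    (Phi : X -> Y -> R) :=
  forall (x0 : X) (N : set Y) (d : R), 0 < d -> open N -> N !=set0 ->
    exists P O, [/\ open P, P !=set0, P `<=` N, nbhs x0 O &
      forall x p, O x -> P p -> `|Phi x p - Phi x0 p| <= d].

Section LocallyJoint.
Variables (R : realType) (X Y : topologicalType) (Phi : X -> Y -> R).
Hypotheses (tX : tychonoff_space X) (pcX : pseudocompact R X).
Hypotheses (tY : tychonoff_space Y) (pcY : pseudocompact R Y).
Hypothesis sPhi : separately_continuous Phi.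

Let cX y : continuous (Phi ^~ y). Proof. exact: sPhi.2. Qed.
Let cY x : continuous (Phi x). Proof. exact: sPhi.1. Qed.

(** If a limit [h] jumps by [e] at [x0], choose alternately open sets [P n] of [Y], on which [Phi]
    is close to [h] at the earlier points and oscillates little near [x0], and points [x n] near
    [x0] with [h (x n)] far from [h x0]. For cluster points [y] and [z] the two orders of
    approximating [Phi z y] give incompatible estimates. *)
Lemma locally_joint_limits : locally_joint Phi -> continuous_limits Phi.
Proof.
move=> LJ h hh; apply: contrapT => /not_continuousP[x0 [e [e0 He]]].
pose d := e / 8; have d0 : 0 < d by apply: divr_gt0.
pose S := (set Y * set X * X * seq X)%type.
(* A state consists of a part [P] of [Y], a neighbourhood [U] of [x0], the newest point [x] and the
   list [l] of the points chosen so far. *)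
pose Inv (a : S) := let: (P, U, x, l) := a in
  [/\ open P, P !=set0, open U, U x0 & [/\ U x, x0 \in l,
   forall x, U x -> forall p, P p -> `|Phi x p - Phi x0 p| <= d & forall p,
     P p -> `|Phi x0 p - h x0| <= d]].
pose Rel (a b : S) := let: (P, U, x, l) := a in let: (P', U', x', l') := b in
  [/\ U' `<=` U, l' = x' :: l, e < `|h x' - h x0| &
   forall x p, x \in l -> P' p -> `|Phi x p - h x| <= d].
have step (P : set Y) (O : set X) (l : seq X) : open O -> O x0 -> x0 \in l ->
  exists P' O' x',
    Inv (P', O', x', x' :: l) /\ Rel (P, O, x', l) (P', O', x', x' :: l).
  move=> oO Ox0 x0l; pose N := [set y | forall x, x \in l -> `|Phi x y - h x| <
    d].
  have oN : open N by apply: open_forall_in => x; apply: open_dist_lt;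
    exact: cY.
  have N0 : N !=set0 by have [y _ Hy] := hh l d d0; exists y.
  have [P' [O1 [oP' P'0 P'N O1x0 HO1]]] := LJ x0 N d d0 oN N0.
  have O'x0 : nbhs x0 (O `&` O1°).
    apply: open_nbhs_nbhs; split; last by [].
    by apply: openI => //; exact: open_interior.
  have [x' [Ox' O1x'] hx'] := He _ O'x0.
  exists P', (O `&` O1°), x'; split; split=> //.
  - by apply: openI => //; exact: open_interior.
  - split=> //; first by rewrite inE x0l orbT.
      by move=> x [_ /interior_subset O1x] p P'p; exact: HO1.
    by move=> p /P'N/(_ _ x0l)/ltW.
  - by move=> x p xl /P'N/(_ x xl)/ltW.
have [P0 [O0 [x' [I0 _]]]] := step setT setT [:: x0] openT I (mem_head _ _).
have [f [f0 If Rf]] : exists f : nat -> S,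
  [/\ f 0%N = (P0, O0, x', [:: x'; x0]),
    forall n, Inv (f n) & forall n, Rel (f n) (f n.+1)].
  apply: iterate_choice => // -[[[P U] x] l] [_ _ oU Ux0 [_ x0l _ _]].
  have [P' [O' [y [Ib Rb]]]] := step P U l oU Ux0 x0l.
  by exists (P', O', y, y :: l).
(* Only [l] is not shifted: [l n] lists the points chosen before [x n], at which [P n] is
   controlled. *)
pose P n := (f n.+1).1.1.1; pose O n := (f n.+1).1.1.2; pose x n :=
  (f n.+1).1.2.
pose l n := (f n).2.
have [IP [OS [lS [ex Pl]]]] : (forall n, [/\ open (P n), P n !=set0,
  open (O n), O n x0 & [/\ O n (x n),
   x0 \in l n, forall v, O n v -> forall p, P n p -> `|Phi v p - Phi x0 p| <= d
   & forall p, P n p -> `|Phi x0 p - h x0| <= d]]) /\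
  (forall n, O n.+1 `<=` O n) /\ (forall n, l n.+1 = x n :: l n) /\
  (forall n, e < `|h (x n) - h x0|) /\
  forall n v p, v \in l n -> P n p -> `|Phi v p - h v| <= d.
  split; [|split; [|split; [|split]]] => n; have := Rf n; have := Rf n.+1;
    have := If n.+1; have := If n; rewrite /P /O /x /l;
    case: (f n) => [[[? ?] ?] ?]; case: (f n.+1) => [[[? ?] ?] ?];
    case: (f n.+2) => [[[? ?] ?] ?] /= [? ? ? ? [? ? ? ?]] [? ? ? ? [? ? ? ?]]
      [? ? ? ?] [? ? ? ?] //.
have OS' m n : (m <= n)%N -> O n `<=` O m.
  by move=> /subnK <-; elim: (n - m)%N => [//|k IH] v /OS/IH.
have ls m n : (m < n)%N -> x m \in l n.
  move=> /subnK <-; elim: (n - m.+1)%N => [|k IH]; rewrite lS ?mem_head//.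
  by rewrite inE IH orbT.
have [y Py] : exists y, cluster_seq P y.
  by apply: (pseudocompact_cluster_seq tY pcY) => n; have [] := IP n.
(* A cluster point of open sets around the [x n], narrow as seen from [y], replaces a cluster point
   of the sequence [x] itself, which need not exist. *)
pose V n := O n `&` [set v | `|Phi v y - Phi (x n) y| < d].
have [z Vz] : exists z, cluster_seq V z.
  apply: (pseudocompact_cluster_seq tX pcX) => n; have [_ _ oO _ [Ox _ _ _]] :=
    IP n.
    by apply: openI => //; apply: open_dist_lt; exact: cX.
  by exists (x n); split=> //=; rewrite subrr normr0.
have near_h : `|Phi z y - h x0| <= 2 * d.
  apply: (cluster_seq_le (N := 0%N) Py (@cY z)) => n _ p Pp.
  apply: (cluster_seq_le (N := n) Vz (@cX p)) => m nm v [/(OS' _ _ nm) Ov _].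
  have [_ _ _ _ [_ _ /(_ v Ov p Pp) H1 /(_ p Pp) H2]] := IP n.
  rewrite (_ : _ - _ = (Phi v p - Phi x0 p) + (Phi x0 p - h x0)); last by ring.
  by apply: le_trans (ler_normD _ _) _; rewrite mulr2n mulrDl mul1r lerD.
have far_h : e - 2 * d <= `|Phi z y - h x0|.
  apply: (cluster_seq_ge (N := 0%N) Vz (@cX y)) => n _ v [_ /= Hv].
  have Hx : `|Phi (x n) y - h (x n)| <= d.
    apply: (cluster_seq_le (N := n.+1) Py (@cY _)) => m nm p Pp.
    by apply: Pl Pp; exact: ls.
  have := ex n; rewrite (_ : h (x n) - h x0 = (Phi v y - h x0) -
    ((Phi v y - Phi (x n) y) + (Phi (x n) y - h (x n)))); last by ring.
  move=> /lt_le_trans/(_ (ler_normB _ _)) H.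
  have := ler_normD (Phi v y - Phi (x n) y) (Phi (x n) y - h (x n)).
  move: H Hx Hv; lra.
by have := le_trans far_h near_h; rewrite /d; lra.
Qed.

(* If every neighbourhood of [x0] were bad for every part of [N], the points
   [p n] would keep [Phi z] close to [c] on [G n], while [Phi z] stays away
   from [c] on the accumulation points of [G n]. *)
Lemma countable_pi_character_joint :
  dense [set y : Y | countable_pi_character y] -> locally_joint Phi.
Proof.
move=> dpi x0 N d d0 oN [y0 Ny0]; apply: contrapT => bad.
(* On [N0] the function [Phi x0] is nearly the constant [c], so an oscillation above [d] becomes a
   distance above [3 / 4 * d] from [c]. *)
pose c := Phi x0 y0; pose N0 := N `&` [set y | `|Phi x0 y - c| < d / 4].
have oN0 : open N0 by apply: openI => //; apply: open_dist_lt; exact: cY.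
have step (P : set Y) (O : set X) : open P -> P !=set0 -> P `<=` N0 ->
  open O -> O x0 ->
    exists V P', [/\ open V, V !=set0, V `<=` O & [/\ open P', P' !=set0,
      P' `<=` P &
      forall v p, V v -> P' p -> 3 / 4 * d <= `|Phi v p - c|]].
  move=> oP P0 PN0 oO Ox0.
  have [x [p [Ox Pp xp]]] : exists x p, [/\ O x, P p & 3 / 4 * d < `|Phi x p -
    c|].
    apply: contrapT => nx; apply: bad; exists P, O; split=> //.
    - by move=> p /PN0[].
    - exact: open_nbhs_nbhs.
    - move=> x p Ox Pp; have [_ /= pc] := PN0 p Pp.
      have xpc : `|Phi x p - c| <= 3 / 4 * d.
        by rewrite leNgt; apply/negP => lt; apply: nx; exists x, p.
      rewrite (_ : _ - _ = (Phi x p - c) - (Phi x0 p - c)); last by ring.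
      apply: le_trans (ler_normB _ _) _; move: pc xpc; lra.
  (* Each [v] near [x] keeps [Phi v] away from [c] on some member of the countable pi-base at [p'].
     By Baire category a single member [Q] works for all [v] in some nonempty open set. *)
  have [p' [[Pp' xp'] [B [cB Bo HB]]]] := dpi _ (ex_intro _ p (conj Pp xp))
    (openI oP (@open_dist_gt _ _ _ c (3 / 4 * d) (@cY x))).
  have [g injg] := countable_injP _ cB.
  pose V0 := O `&` [set v | 3 / 4 * d < `|Phi v p' - c|].
  pose F n := [set v | exists Q, [/\ B Q, g Q = n, Q `<=` P &
    forall q, Q q -> 3 / 4 * d <= `|Phi v q - c|]].
  have clF n : closed (F n).
    have [[Q [BQ gQ QP]]|nQ] := pselect (exists Q, [/\ B Q, g Q = n
      & Q `<=` P]); last first.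
      have -> : F n = set0 by apply/seteqP; split=> // v [Q [? ? ? _]];
        apply: nQ; exists Q.
      exact: closed0.
    have -> : F n = \bigcap_(q in Q) [set v | 3 / 4 * d <= `|Phi v q - c|].
      apply/seteqP; split=> [v [Q' [BQ' gQ' _ H]] q Qq|v H]; last by exists Q.
      by apply: H; rewrite (injg Q' Q) ?inE// gQ gQ'.
    by apply: closed_bigI => q _; apply: closed_dist_ge; exact: cX.
  have [n [V [oV V0' VF]]] : exists n V, [/\ open V, V !=set0 & V `<=` V0 `&` F
    n].
    apply: (pseudocompact_baire_cover tX pcX) => //.
    - by apply: openI => //; apply: open_dist_gt; exact: cX.
    - by exists x.
    - move=> v [_ /= vp']; have [Q BQ HQ] :=
      HB (P `&` [set q | 3 / 4 * d < `|Phi v q - c|])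
        (open_nbhs_nbhs (conj (openI oP (@open_dist_gt _ _ _ c (3 / 4 * d)
          (@cY v))) (conj Pp' vp'))).
      exists (g Q) => //; exists Q; split=> // [q /HQ[]//|q /HQ[_ /ltW]//].
  have [v Vv] := V0'; have [_ [Q [BQ gQ QP _]]] := VF v Vv; have [oQ Q0] :=
    Bo Q BQ.
  exists V, Q; split=> //; first by move=> u /VF[[]].
  split=> // u q /VF[_ [Q' [BQ' gQ' _ H]]] Qq; apply: H.
  by rewrite (injg Q' Q) ?inE// gQ gQ'.
pose S := (set Y * set X * seq Y)%type.
pose Inv (a : S) := [/\ open a.1.1, a.1.1 !=set0 & a.1.1 `<=` N0].
pose Rel (a b : S) := exists p, [/\ a.1.1 p, b.2 = p :: a.2, open b.1.2,
  b.1.2 !=set0 & [/\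
  forall v q, b.1.2 v -> q \in b.2 -> `|Phi v q - Phi x0 q| < d / 4,
  b.1.1 `<=` a.1.1 & forall v q, b.1.2 v -> b.1.1 q -> 3 / 4 * d <= `|Phi v q -
    c|]].
have N00 : N0 !=set0 by exists y0; split=> //=; rewrite subrr normr0 divr_gt0.
have [f [f0 If Rf]] : exists f : nat -> S, [/\ f 0%N = (N0, set0, [::]),
    forall n, Inv (f n) & forall n, Rel (f n) (f n.+1)].
  apply: iterate_choice; first by split.
  move=> [[P V'] l] [/= oP P0 PN0]; have [p Pp] := P0.
  pose O := [set v | forall q, q \in p :: l -> `|Phi v q - Phi x0 q| < d / 4].
  have [V [P' [oV V0 VO [oP' P'0 P'P H]]]] : exists V P', [/\ open V, V !=set0,
    V `<=` O &
      [/\ open P', P' !=set0, P' `<=` P &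
      forall v p, V v -> P' p -> 3 / 4 * d <= `|Phi v p - c|]].
    apply: step => //; first by apply: open_forall_in => q;
      apply: open_dist_lt; exact: cX.
    by move=> q _; rewrite subrr normr0 divr_gt0.
  exists (P', V, p :: l); first by split=> //= q /P'P/PN0.
  exists p; split=> //; split=> // v q Vv ql; exact: VO.
have [p Hp] := choice Rf.
pose P n := (f n).1.1; pose V n := (f n.+1).1.2; pose l n := (f n.+1).2.
have PS m n : (m <= n)%N -> P n `<=` P m.
  move=> /subnK <-; elim: (n - m)%N => [//|k IH] q Pq; apply: IH.
  by have [_ _ _ _ [_ + _]] := Hp (k + m)%N; apply.
have pl m n : (m <= n)%N -> p m \in l n.
  move=> /subnK <-; elim: (n - m)%N => [|k IH].
    by have [_ lE _ _ _] := Hp m; rewrite /l add0n lE mem_head.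
  by have [_ lE _ _ _] := Hp (k.+1 + m)%N; rewrite /l lE inE -/(l _) IH orbT.
have [z Vz] : exists z, cluster_seq V z.
  by apply: (pseudocompact_cluster_seq tX pcX) => n; have [] := Hp n.
have zp n : `|Phi z (p n) - c| <= d / 2.
  have H1 : `|Phi z (p n) - Phi x0 (p n)| <= d / 4.
    apply: (cluster_seq_le (N := n) Vz (@cX _)) => m nm v Vv.
    by apply: ltW; have [_ _ _ _ [+ _ _]] := Hp m; apply=> //; exact: pl.
  have [Pp _ _ _ _] := Hp n; have [_ _ PN0] := If n; have [_ /= H2] := PN0 _ Pp.
  rewrite (_ : _ - _ = (Phi z (p n) - Phi x0 (p n)) + (Phi x0 (p n) - c));
    last by ring.
  by apply: le_trans (ler_normD _ _) _; move: H1 H2; lra.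
(* The bound [5 / 8 * d] lies strictly between the [d / 2] known at [p n] and the [3 / 4 * d] that
   gives the contradiction. *)
pose G n := P n `&` [set q | `|Phi z q - c| < 5 / 8 * d].
have [y Gy] : exists y, cluster_seq G y.
  apply: (pseudocompact_cluster_seq tY pcY) => n.
    by apply: openI; [have [] := If n|apply: open_dist_lt; exact: cY].
  exists (p n); split; first by have [] := Hp n.
  by apply: le_lt_trans (zp n) _; lra.
have near_c : `|Phi z y - c| <= 5 / 8 * d.
  by apply: (cluster_seq_le (N := 0%N) Gy (@cY z)) => n _ q [_ /ltW].
have far_c : 3 / 4 * d <= `|Phi z y - c|.
  apply: (cluster_seq_ge (N := 0%N) Vz (@cX y)) => n _ v Vv.
  apply: (cluster_seq_ge (N := n.+1) Gy (@cY v)) => m nm q [/(PS _ _ nm) Pq _].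
  by have [_ _ _ _ [_ _ +]] := Hp n; apply.
by have := le_trans far_c near_c; lra.
Qed.

Lemma Namioka_locally_joint (D : set Y) : dense D ->
  (forall x y, D y -> {for (x, y), continuous (uncurry Phi)}) ->
    locally_joint Phi.
Proof.
move=> dD jc x0 N d d0 oN N0; have [y [Ny Dy]] := dD N N0 oN.
have d20 : 0 < d / 2 by apply: divr_gt0.
have /cvgrPdist_lt/(_ _ d20)[[O P] /= [Ox0 Py] HOP] := jc x0 y Dy.
exists (N `&` P°), O; split=> //.
- by apply: openI => //; exact: open_interior.
- by exists y.
- move=> x p Ox [_ /interior_subset Pp].
  have H1 := HOP (x, p) (conj Ox Pp).
  have H2 := HOP (x0, p) (conj (nbhs_singleton Ox0) Pp).
  rewrite /= in H1 H2.
  rewrite (_ : _ - _ = (Phi x0 y - Phi x0 p) - (Phi x0 y - Phi x p));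
    last by ring.
  by apply: le_trans (ler_normB _ _) _; apply: ltW; rewrite [ltRHS]splitr ltrD.
Qed.

Lemma limits_pointwise_bounded x : exists M, forall y, `|Phi x y| <= M.
Proof. by have [M _ HM] := pseudocompact_bounded pcY (@cY x); exists M. Qed.

(** For each [n] the open sets on which all [Phi x] oscillate by at most [n.+1%:R^-1] have a dense
    union, by fragmentation; Baire category intersects these unions. *)
Lemma continuous_limits_generic : continuous_limits Phi ->
  exists D : set Y, [/\ dense D, Gdelta D & forall y, D y -> forall e, 0 < e ->
    exists W, nbhs y W /\ forall x w, W w -> `|Phi x w - Phi x y| <= e].
Proof.
move=> limC.
pose G n (W : set Y) := open W /\
  forall x w w', W w -> W w' -> `|Phi x w - Phi x w'| <= n.+1%:R^-1.
pose U n := \bigcup_(W in G n) W.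
have oU n : open (U n) by apply: bigcup_open => W [].
exists (\bigcap_n U n); split.
- apply: (pseudocompact_dense_bigcap tY pcY) => // n O O0 oO.
  have n0 : 0 < n.+1%:R^-1 :> R by rewrite invr_gt0.
  have [W [oW [w Ww] WO HW]] := fragmentation tX pcX sPhi
    limits_pointwise_bounded limC n0 oO O0.
  by exists w; split; [exact: WO|exists W].
- by exists U.
- move=> y Dy e /harmonic_lt[n /(_ n (leqnn n)) ne].
  have [W [oW HW] Wy] := Dy n I; exists W; split; first exact: open_nbhs_nbhs.
  by move=> x w Ww; apply: le_trans (HW _ _ _ Ww Wy) (ltW ne).
Qed.

End LocallyJoint.

(** * Convergence in initial topologies, and compactness *)

Lemma initial_cvgP (S : choiceType) (T : topologicalType) (f : S -> T)
    (F : set_system S) (s : S) : Filter F ->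
  (F --> (s : initial_topology f)) <-> (f x @[x --> F] --> f s).
Proof.
move=> FF; split=> [Fs|Ffs].
  apply: cvg_trans (@initial_continuous S T f s).
  exact: cvg_app.
move=> A [_ /= [[B oB <-] Bfs] BA]; apply: filterS BA _.
by apply: Ffs; exact: open_nbhs_nbhs.
Qed.

Lemma ptws_cvgP (I : choiceType) (T : topologicalType) (F :
  set_system {ptws I -> T})
    (f : {ptws I -> T}) : Filter F ->
  (F --> f) <-> forall i, g i @[g --> F] --> f i.
Proof.
move=> FF; rewrite cvg_sup; split=> H i.
  have /initial_cvgP := H i; exact.
by apply/initial_cvgP; exact: H.
Qed.

Lemma ptws_eval_continuous (I : choiceType) (T : topologicalType) (i : I) :
  continuous (fun f : {ptws I -> T} => f i).
Proof. by move=> f; have /ptws_cvgP := @cvg_id _ (nbhs f); exact. Qed.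

Lemma compact_setT (T : topologicalType) (A : set T) :
  compact A <-> compact [set: set_type A].
Proof.
split=> cA.
  move=> F FF _; have FA : (\val @ F) A.
    apply: (@filterS _ F _ setT); last exact: filterT.
    by move=> f _; exact: set_valP.
  have [a [Aa Fa]] := cA _ _ FA; exists (exist _ a (mem_set Aa));
    split=> // B C FB.
  move=> [_ [[D oD <-] /= Da] DC].
  have [_ [[b Bb <-] Db]] := Fa (\val @` B) D (filterS (@preimage_image _ _ _
    _) FB)
    (open_nbhs_nbhs (conj oD Da)).
  by exists b; split=> //; exact: DC.
have -> : A = \val @` [set: set_type A].
  apply/seteqP; split=> [a Aa|_ [a _ <-]]; last exact: set_valP.
  by exists (exist _ a (mem_set Aa)).
apply: continuous_compact => //; apply: continuous_subspaceT.
exact: initial_continuous.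
Qed.

Lemma compact_pseudocompact (R : realType) (T : topologicalType) :
  compact [set: T] -> pseudocompact R T.
Proof.
move=> cT f cf.
have /compact_bounded : compact (f @` setT).
  by apply: continuous_compact => //; exact: continuous_subspaceT.
case=> M [Mr HM]; exists M; split=> // N MN x _; apply: (HM N MN).
by exists x.
Qed.

(** The image of a compact space in a power of the reals is closed: an ultrafilter realizing [h]
    clusters at some [y], and continuity in [y] identifies the limit. *)
Lemma compact_pointwise_limit (R : realType) (X : eqType) (Y : topologicalType)
    (Phi : X -> Y -> R) h :
  compact [set: Y] -> (forall x, continuous (Phi x)) ->
  pointwise_limit Phi setT h -> exists y, h = Phi ^~ y.
Proof.
move=> cY cPhi /pointwise_limit_ultra[F [FU _ Fh]].
have [y [_ Fy]] := cY F _ (@filterT _ F _); exists y; apply/funext => x.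
move: Fy; rewrite cluster_cvgE => -[G PG [Gy FG]].
have Gx : Phi x u @[u --> G] --> Phi x y.
  by apply: cvg_trans (cPhi x y); exact: cvg_app.
apply: (cvg_unique _ _ Gx) => //.
apply: cvg_trans (Fh x) => A FA; exact: (FG (Phi x @^-1` A) FA).
Qed.

(** * The space [Cp] and compact closures in it *)

Section Cp.
Variables (R : realType) (X : topologicalType).

Lemma Cp_cvgP (F : set_system (Cp R X)) (f : Cp R X) : Filter F ->
  (F --> f) <-> forall x, (g : continuousType X R) x @[g --> F] -->
    (f : continuousType X R) x.
Proof. by move=> FF; rewrite initial_cvgP ptws_cvgP. Qed.

Lemma set_Cp_cvgP (Y : set (Cp R X)) (F : set_system (set_type Y)) (f :
  set_type Y) :
  Filter F ->
  (F --> f) <-> forall x, (\val g : continuousType X R) x @[g --> F] -->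
    (\val f : continuousType X R) x.
Proof. by move=> FF; rewrite initial_cvgP Cp_cvgP. Qed.

Definition eval_on (Y : set (Cp R X)) (x : X) (f : set_type Y) : R :=
  (\val f : continuousType X R) x.

Lemma eval_on_sep (Y : set (Cp R X)) : separately_continuous (@eval_on Y).
Proof.
split=> [x f|f x]; last exact: cts_fun.
by have /set_Cp_cvgP := @cvg_id _ (nbhs f); exact.
Qed.

Lemma set_Cp_nbhs_basis (Y : set (Cp R X)) (f : set_type Y) A : nbhs f A ->
  exists (s : seq X) (e : R), 0 < e /\ forall g : set_type Y,
    (forall x, x \in s -> `|eval_on x g - eval_on x f| < e) -> A g.
Proof.
pose F := filter_from [set se : seq X * R | 0 < se.2] (fun se =>
  [set g : set_type Y | forall x, x \in se.1 -> `|eval_on x g - eval_on x f| <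
    se.2]).
have FF : Filter F.
  apply: filter_from_filter; first by exists ([::], 1) => /=.
  move=> [s1 e1] [s2 e2] /= e10 e20.
  exists (s1 ++ s2, Num.min e1 e2) => /=; first by rewrite lt_min e10.
  move=> g Hg; split=> x xs.
    by have := Hg x; rewrite mem_cat xs => /(_ isT); rewrite lt_min => /andP[].
  by have := Hg x; rewrite mem_cat xs orbT => /(_ isT); rewrite lt_min =>
    /andP[].
have Ff : F --> f.
  apply/set_Cp_cvgP => x; apply/cvgrPdistC_lt => e e0; exists ([:: x],
    e) => //= g.
  by apply; exact: mem_head.
by move=> /Ff[[s e] /= e0 HA]; exists s, e.
Qed.

Lemma set_Cp_tychonoff (Y : set (Cp R X)) : tychonoff_space (set_type Y).
Proof.
split; last first.
  move=> f B clB nBf.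
  have [s [e [e0 He]]] := set_Cp_nbhs_basis (open_nbhs_nbhs
    (conj (closed_openC clB) nBf)).
  have [cev _] := eval_on_sep Y.
  apply/(@uniform_separatorP _ R).
  (* [S] vanishes at [f], and [S g < 1] puts [g] in the basic neighbourhood that avoids [B];
     truncation at 1 gives the separating function. *)
  pose S (g : set_type Y) : R := \sum_(x <- s) `|eval_on x g - eval_on x f| / e.
  have S0 g : 0 <= S g by apply: sumr_ge0 => x _; rewrite divr_ge0// ltW.
  have cS : continuous S := continuous_sum (s := s)
    (fun x => @continuous_dist_div _ _ _ (eval_on x f) e (@cev x)).
  exists (fun g => Num.min 1 (S g)); split.
  - exact: (continuous_fmin (@continuous_fcst _ _ _) cS).
  - by move=> _ [g _ <-] /=; rewrite in_itv /= le_min ler01 S0 ge_min lexx.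
  - move=> _ [_ -> <-] /=; rewrite /S big1 ?min_r// => x _.
    by rewrite subrr normr0 mul0r.
  - move=> _ [g Bg <-] /=; apply/min_idPl; rewrite leNgt; apply/negP => S1.
    apply: (He g _ Bg) => x xs; rewrite -[e]mul1r -ltr_pdivrMr//.
    apply: le_lt_trans S1; rewrite /S (big_rem x)//= lerDl.
    by apply: sumr_ge0 => y _; rewrite divr_ge0// ltW.
move=> p q pq; apply: val_inj; apply/continuousEP => x; apply: contrapT => npq.
pose e := `|eval_on x p - eval_on x q|.
have e0 : 0 < e by rewrite normr_gt0 subr_eq0; exact/eqP.
have e20 : 0 < e / 2 by apply: divr_gt0.
have [cev _] := eval_on_sep Y.
have nb (f : set_type Y) : nbhs f [set g | `|eval_on x g - eval_on x f| < e /
  2].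
  apply: open_nbhs_nbhs; split; first by apply: open_dist_lt; exact: cev.
  by rewrite /= subrr normr0.
have [f [/= fp fq]] := pq _ _ (nb p) (nb q).
have := ler_normB (eval_on x f - eval_on x q) (eval_on x f - eval_on x p).
rewrite (_ : _ - _ = eval_on x p - eval_on x q); last by ring.
by rewrite -/e; lra.
Qed.

Lemma pseudocompact_Cp_bounded (Y : set (Cp R X)) : pseudocompact R
  (set_type Y) ->
  forall x, exists M, forall f : set_type Y, `|eval_on x f| <= M.
Proof.
move=> pcY x; have [cev _] := eval_on_sep Y.
by have [M _ HM] := pseudocompact_bounded pcY (@cev x); exists M.
Qed.

Lemma Cp_near (f : Cp R X) (s : seq X) (e : R) : 0 < e ->
  nbhs f [set g : Cp R X | forall x, x \in s ->
    `|(g : continuousType X R) x - (f : continuousType X R) x| < e].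
Proof.
move=> e0; apply: filter_forall_in => x _.
have /Cp_cvgP/(_ x)/cvgrPdistC_lt := @cvg_id _ (nbhs f); exact.
Qed.

Lemma closure_pointwise_limit (Y : set (Cp R X)) (f : Cp R X) : closure Y f ->
  pointwise_limit (@eval_on Y) setT (f : continuousType X R).
Proof.
move=> Yf s e e0; have [g [Yg Hg]] := Yf _ (Cp_near f s e0).
by exists (exist _ g (mem_set Yg)).
Qed.

Lemma pointwise_limit_closure (Y : set (Cp R X)) (f : Cp R X) :
  pointwise_limit (@eval_on Y) setT (f : continuousType X R) -> closure Y f.
Proof.
move=> /pointwise_limit_ultra[F [FU _ Ff]].
have Ff' : \val @ F --> f by apply/Cp_cvgP.
move=> A nA; have FA : F (\val @^-1` A) := Ff' A nA.
have [g Ag] := filter_ex FA; exists (\val g); split=> //.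
exact: set_valP.
Qed.

(** Pseudocompactness bounds [Y] at each point, so its closure in the full power of the reals is
    compact; the closure in [Cp R X] is compact exactly when it already contains all these
    limits. *)
Lemma compact_closure_limits (Y : set (Cp R X)) : pseudocompact R
  (set_type Y) ->
  compact (closure Y) <-> continuous_limits (@eval_on Y).
Proof.
move=> pcY; split=> [/compact_setT cY h hY|limC].
  have hcl : pointwise_limit (@eval_on (closure Y)) setT h.
    move=> s e e0; have [f _ Hf] := hY s e e0.
    by exists (exist _ (\val f) (mem_set (subset_closure (set_valP f)))).
  by have [f ->] := compact_pointwise_limit cY (eval_on_sep _).1 hcl;
    exact: (eval_on_sep _).2.
rewrite compact_ultra => F FU FY.
have bndF x : exists M, F [set f : Cp R X | `|(f : continuousType X R) x| <= M].
  have [M HM] := pseudocompact_Cp_bounded pcY x; exists M; apply: filterS FY =>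
    f Yf.
  apply/ler_addgt0Pr => e e0; have [g _] := closure_pointwise_limit Yf [:: x]
    e0.
  move=> /(_ x (mem_head _ _)) gf; rewrite -[X in `|X|](subrK (eval_on x g)).
  apply: le_trans (ler_normD _ _) _; rewrite addrC distrC; apply: lerD (HM g)
    (ltW gf).
have [h Fh] := ultra_pointwise_cvg (Phi := fun x (f : Cp R X) =>
  (f : continuousType X R) x)
  (y := id) FU bndF.
have hY : pointwise_limit (@eval_on Y) setT h.
  move=> s e e0; have e20 : 0 < e / 2 by apply: divr_gt0.
  have Fs : F [set f : Cp R X | forall x, x \in s ->
      `|(f : continuousType X R) x - h x| < e / 2].
    by apply: filter_forall_in => x _; have /cvgrPdistC_lt := Fh x; apply.
  have [f [Yf Hf]] := filter_ex (filterI FY Fs).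
  have [g _ Hg] := closure_pointwise_limit Yf s e20; exists g => // x xs.
  rewrite -(subrK ((f : continuousType X R) x) (eval_on x g)) -addrA
    [ltRHS]splitr.
  by apply: le_lt_trans (ler_normD _ _) _; rewrite ltrD ?Hg ?Hf.
pose f : Cp R X := mkcts (limC h hY); exists f; split; last by apply/Cp_cvgP.
exact: pointwise_limit_closure.
Qed.

End Cp.

Lemma pseudocompact_image (R : realType) (S T : topologicalType) (f : S -> T) :
  continuous f -> pseudocompact R S -> pseudocompact R (set_type (range f)).
Proof.
move=> cf pcS g cg.
pose f' s : set_type (range f) := exist _ (f s) (mem_set (imageT f s)).
have cf' : continuous f' by apply: continuous_comp_initial => s; exact: cf.
have [M M0 HM] := pseudocompact_bounded (f := g \o f') pcS (fun s =>
  continuous_comp (cf' s) (cg (f' s))).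
exists M; split; first exact: num_real.
move=> N MN [t /= tf] _; have [s _ st] := set_mem tf.
suff -> : exist _ t tf = f' s by apply: le_trans (HM s) (ltW MN).
by apply: val_inj; rewrite /= st.
Qed.

(** * Exchanging the roles of points and functions *)

Section Duality.
Variables (R : realType).

Lemma continuous_Cp_map (X Y : topologicalType) (Phi : X -> Y -> R)
    (sPhi : separately_continuous Phi) :
  continuous (fun y => mkcts (sPhi.2 y) : Cp R X).
Proof. by move=> y; apply/Cp_cvgP => x; exact: sPhi.1. Qed.

Lemma compact_image_limits (X Y : topologicalType) (Phi : X -> Y -> R)
    (sPhi : separately_continuous Phi) :
  pseudocompact R Y ->
  compact (closure (range (fun y => mkcts (sPhi.2 y) : Cp R X))) ->
  continuous_limits Phi.
Proof.
move=> pcY; set f := (X in range X).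
have pcf := pseudocompact_image (@continuous_Cp_map _ _ _ sPhi) pcY.
move=> /(compact_closure_limits pcf) limC h hh; apply: limC => s e e0.
have [y _ Hy] := hh s e e0.
by exists (exist _ (f y) (mem_set (imageT f y))).
Qed.

Lemma sep_sym (X Y : topologicalType) (Phi : X -> Y -> R) :
  separately_continuous Phi -> separately_continuous (fun y x => Phi x y).
Proof. by case. Qed.

(** Limits of the evaluations at points of a compact [T] are again evaluations, hence continuous on
    [Z]. The double limit argument, run on the pseudocompact space [Z], carries this over to limits
    of members of [Z]. *)
Lemma compact_weakly_pc (T : topologicalType) :
  compact [set: T] -> weakly_pc_Grothendieck R T.
Proof.
move=> cT Z pcZ; apply/(compact_closure_limits pcZ).
have sZ := eval_on_sep Z.
apply: (@continuous_limits_sym _ _ _ (fun z t => eval_on t z) (set_Cp_tychonoff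
  Z) pcZ).
- exact: sep_sym.
- move=> z; have [M _ HM] := pseudocompact_bounded (compact_pseudocompact (R :=
  R) cT)
    (@cts_fun _ _ (\val z : continuousType T R)).
  by exists M.
- by move=> h /(compact_pointwise_limit cT (fun z => @sZ.2 z))[t ->];
  exact: sZ.1.
Qed.

Lemma limits_sym (X Y : topologicalType) (Phi : X -> Y -> R) :
  tychonoff_space X -> pseudocompact R X -> pseudocompact R Y ->
  separately_continuous Phi ->
  continuous_limits Phi -> continuous_limits (fun y x => Phi x y).
Proof.
move=> tX pcX pcY sPhi; apply: continuous_limits_sym => //.
exact: limits_pointwise_bounded.
Qed.

(** Evaluation maps [X] onto a pseudocompact subspace of the function space over [Y]. Its closure is
    compact by assumption, so limits of evaluations are continuous, and symmetry gives the claim. *)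
Lemma weakly_pc_limits (X : topologicalType) (Y : set (Cp R X)) :
  tychonoff_space X -> pseudocompact R X -> pseudocompact R (set_type Y) ->
  weakly_pc_Grothendieck R (set_type Y) -> continuous_limits (@eval_on R X Y).
Proof.
move=> tX pcX pcY wY.
apply: (limits_sym (Phi := fun f x => eval_on x f)) => //.
- exact: set_Cp_tychonoff.
- exact: sep_sym (eval_on_sep Y).
- have sY := sep_sym (eval_on_sep Y).
  apply: (compact_image_limits (sPhi := sY)) => //; apply: wY.
  exact: pseudocompact_image (@continuous_Cp_map _ _ _ sY) pcX.
Qed.

End Duality.

Lemma countable_character_pi (T : topologicalType) (x : T) :
  countable_character x -> countable_pi_character x.
Proof.
move=> [B [cB Bx HB]]; exists [set interior V | V in B]; split.
- exact: sub_countable (card_image_le _ _) cB.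
- by move=> _ [V BV <-]; split; [exact: open_interior|exists x; exact: Bx].
- move=> U /HB[V BV VU]; exists V°; first by exists V.
  by move=> y /interior_subset/VU.
Qed.

(** * Pointwise and uniform neighbourhoods *)

Section UniformTopology.
Variables (R : realType) (X : topologicalType) (Y : set (Cp R X)).

Lemma set_Cu_nbhsP (f : set_type Y) (A : set (set_type Y)) :
  @nbhs _ (set_type (Y : set (Cu R X))) f A <->
  exists2 e : R, 0 < e & forall g : set_type Y,
    (forall x, `|eval_on x g - eval_on x f| <= e) -> A g.
Proof.
split.
  move=> [_ [[_ [C oC <-] <-]] /= Cf CA].
  have /uniform_nbhs[E [entE EC]] := open_nbhs_nbhs (conj oC Cf).
  move: entE; rewrite -entourage_ballE => -[e /= e0 eE]; exists (e / 2) =>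
    [|g Hg].
    exact: divr_gt0.
  apply: CA; apply: EC => x _; apply: eE; rewrite /ball /= distrC.
  by apply: le_lt_trans (Hg x) _; rewrite ltr_pdivrMr// ltr_pMr// ltr1n.
move=> [e e0 eA].
have nC : nbhs ((\val f : continuousType X R) : {uniform X -> R})
    [set h : {uniform X -> R} | forall x, `|h x - eval_on x f| <= e].
  apply/uniform_nbhs; exists [set rs | ball rs.1 e rs.2]; split.
    by rewrite -entourage_ballE; exists e.
  by move=> h Hh x; have := Hh x I; rewrite /ball /= distrC => /ltW.
have n1 := @initial_continuous (continuousType X R) _
  (fun f : continuousType X R => (f : {uniform X -> R})) (\val f) _ nC.
have n2 := @initial_continuous (set_type (Y : set (Cu R X))) (Cu R X) set_val f
  _ n1.
pose fu : set_type (Y : set (Cu R X)) := f.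
have FF : Filter (nbhs fu) := nbhs_filter fu.
exact: (@filterS _ (nbhs fu) FF _ _ _ n2).
Qed.

Lemma pointwise_uniform_coincideP (f : set_type Y) :
  (forall e : R, 0 < e -> \forall g \near f, forall x, `|eval_on x g - eval_on
    x f| <= e) ->
  pointwise_uniform_coincide f.
Proof.
move=> Hf; apply/seteqP; split=> A.
  move=> /set_Cp_nbhs_basis[s [e [e0 HA]]]; apply/set_Cu_nbhsP; exists (e / 2).
    exact: divr_gt0.
  move=> g Hg; apply: HA => x _; apply: le_lt_trans (Hg x) _.
  by rewrite ltr_pdivrMr// ltr_pMr// ltr1n.
by move=> /set_Cu_nbhsP[e /Hf He HA]; apply: filterS He.
Qed.

Lemma pointwise_uniform_coincide_near (f : set_type Y) :
  pointwise_uniform_coincide f ->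
  forall e : R, 0 < e -> \forall g \near f, forall x, `|eval_on x g - eval_on x
    f| <= e.
Proof.
move=> Hf e e0; rewrite /pointwise_uniform_coincide in Hf.
rewrite /prop_near1 /in_filter /= Hf; apply/set_Cu_nbhsP; exists e => //.
Qed.

Lemma coincide_countable_character (f : set_type Y) :
  pointwise_uniform_coincide f -> countable_character f.
Proof.
move=> Hf; pose B n := [set g : set_type Y |
  forall x, `|eval_on x g - eval_on x f| <= n.+1%:R^-1].
exists (range B); split.
- exact: sub_countable (card_image_le _ _) (countableP _).
- move=> _ [n _ <-]; apply: (pointwise_uniform_coincide_near Hf).
  by rewrite invr_gt0.
- move=> U; rewrite Hf => /set_Cu_nbhsP[e /harmonic_lt[n /(_ n (leqnn n)) ne]
  HU].
  exists (B n); first by exists n.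
  by move=> g Bg; apply: HU => x; apply: le_trans (Bg x) (ltW ne).
Qed.

End UniformTopology.

(** * Pseudocompact sets with continuous limits are compact *)

Section PreissSimon.
Variables (R : realType) (X : topologicalType).
Hypotheses (tX : tychonoff_space X) (pcX : pseudocompact R X).
Variable Y : set (Cp R X).
Hypothesis pcY : pseudocompact R (set_type Y).
Hypothesis limC : continuous_limits (@eval_on R X Y).

Let tY := set_Cp_tychonoff Y.
Let sY := eval_on_sep Y.

Lemma limits_coincide_dense : dense [set f : set_type Y |
  pointwise_uniform_coincide f].
Proof.
have [D [dD _ HD]] := continuous_limits_generic tX pcX tY pcY sY limC.
move=> O O0 oO; have [f [Of Df]] := dD O O0 oO; exists f; split=> //.
apply: pointwise_uniform_coincideP => e e0; have [W [fW HW]] := HD f Df e e0.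
by apply: filterS fW => g Wg x; exact: HW.
Qed.

(* [f n] runs through points of coincidence, so that the neighbourhoods [W n]
   can only accumulate at the pointwise limit [p] of the [f n]. *)
Lemma limits_compact : compact Y.
Proof.
(* The closure is already known to be compact, so only closedness is left. *)
suff -> : Y = closure Y by apply/(compact_closure_limits pcY).
apply/seteqP; split=> [|p Yp]; first exact: subset_closure.
pose D := [set f : set_type Y | pointwise_uniform_coincide f].
have pD : pointwise_limit (@eval_on R X Y) D (p : continuousType X R).
  move=> s e e0; have e20 : 0 < e / 2 by apply: divr_gt0.
  have [f _ Hf] := closure_pointwise_limit Yp s e20.
  pose O := [set g : set_type Y | forall x, x \in s -> `|eval_on x g - eval_on
    x f| < e / 2].
  have [||g [Og Dg]] := limits_coincide_dense (O := O).
  - by exists f => x _; rewrite subrr normr0.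
  - by apply: open_forall_in => x; apply: open_dist_lt; exact: sY.1.
  exists g => // x xs; rewrite -(subrK (eval_on x f) (eval_on x g)) -addrA
    [ltRHS]splitr.
  by apply: le_lt_trans (ler_normD _ _) _; rewrite ltrD ?Hf ?Og.
have [||f Df fp] := pointwise_limit_seq tX pcX sY (D := D) _ _ pD.
- by move=> x; have [M HM] := pseudocompact_Cp_bounded pcY x; exists M.
- by move=> h /(pointwise_limitS (@subsetT _ _)); exact: limC.
pose W n := [set g : set_type Y | forall x, `|eval_on x g - eval_on x (f n)| <=
  n.+1%:R^-1]°.
have [y Wy] : exists y, cluster_seq W y.
  apply: (pseudocompact_cluster_seq tY pcY) => n; first exact: open_interior.
  by exists (f n); apply: (pointwise_uniform_coincide_near (Df n));
    rewrite invr_gt0.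
suff -> : p = \val y by exact: set_valP.
apply/continuousEP => x; apply/esym; apply: small_eq => e e0.
have e20 : 0 < e / 2 by apply: divr_gt0.
have [N HN] := harmonic_lt e20; have /cvgrPdistC_lt/(_ _ e20)[M _ HM] := fp x.
apply: (cluster_seq_le (N := maxn M N) Wy (@sY.1 x)) => n.
rewrite geq_max => /andP[Mn Nn] g /interior_subset Wg.
rewrite -(subrK (eval_on x (f n)) (eval_on x g)) -addrA [leRHS]splitr.
apply: le_trans (ler_normD _ _) _; apply: lerD; last exact: ltW (HM n Mn).
exact: le_trans (Wg x) (ltW (HN n Nn)).
Qed.

End PreissSimon.

(** * Dini's theorem and bounded convergence for functionals *)

Section BoundedConvergence.
Variables (R : realType) (X : topologicalType).
Hypotheses (tX : tychonoff_space X) (pcX : pseudocompact R X).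

(** If the open sets where [K n] exceeds [e] are all nonempty, they have a cluster point [z], and by
    monotonicity [e <= K n z] for every [n]. *)
Lemma Dini (K : nat -> X -> R) e : 0 < e -> (forall n, continuous (K n)) ->
  (forall n x, K n.+1 x <= K n x) -> (forall x, exists n, K n x < e) ->
  exists n, forall x, K n x <= e.
Proof.
move=> e0 cK dK K0; apply: contrapT => H.
have KS m n x : (m <= n)%N -> K n x <= K m x.
  by move=> /subnK <-; elim: (n - m)%N => [//|k IH]; apply: le_trans IH;
    exact: dK.
have [z Vz] : exists z, cluster_seq (fun n => [set x | e < K n x]) z.
  apply: (pseudocompact_cluster_seq tX pcX) => n.
    have -> : [set x | e < K n x] = K n @^-1` [set r | e < r] by [].
    by apply: open_comp; [move=> x _; exact: cK|exact: open_gt].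
  apply: contrapT => nx; apply: H; exists n => x; rewrite leNgt; apply/negP =>
    lt.
  by apply: nx; exists x.
have [n] := K0 z; rewrite ltNge => /negP; apply.
have clK : closed [set x | e <= K n x].
  have -> : [set x | e <= K n x] = K n @^-1` [set r | e <= r] by [].
  by apply: preimage_closed; [move=> x _; exact: cK|exact: closed_ge].
apply: (cluster_seq_closed (N := n) Vz clK) => m nm x /= /ltW/le_trans; apply.
exact: KS.
Qed.

Variables (L : (X -> R) -> R) (C : R).
Implicit Types (f g : X -> R) (M : R).

Hypothesis L_add : forall f g, continuous f -> continuous g ->
  L (fun x => f x + g x) = L f + L g.
Hypothesis L_bound : forall f M, continuous f -> (forall x, `|f x| <= M) ->
  0 <= M ->
  L f <= C * M.

Let L0 : L (fun=> 0) = 0.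
Proof.
have c0 := @continuous_fcst R X 0.
have := L_add c0 c0; under eq_fun do rewrite addr0.
by move=> E; apply: (addrI (L (fun=> 0))); rewrite -E addr0.
Qed.

Let LN f : continuous f -> L (fun x => - f x) = - L f.
Proof.
move=> cf; have cN := continuous_fopp cf.
have := L_add cf cN; under eq_fun do rewrite subrr.
by rewrite L0 => /esym/eqP; rewrite addrC addr_eq0 => /eqP.
Qed.

(* The total variation of [L]. *)
Let A f := [set r | exists g : X -> R, [/\ continuous g, forall x,
  `|g x| <= f x & r = L g]].
Let mu f := sup (A f).

Let has_supA f M : (forall x, 0 <= f x) -> (forall x, f x <= M) -> 0 <= M ->
  has_sup (A f) /\ ubound (A f) (C * M).
Proof.
move=> f0 fM M0; have ub : ubound (A f) (C * M).
  by move=> _ [g [cg gf ->]]; apply: L_bound => // x; exact: le_trans (gf x)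
    (fM x).
split=> //; split; last by exists (C * M).
exists 0, (fun=> 0); split=> //; first exact: continuous_fcst.
by move=> x; rewrite normr0.
Qed.

Let hsA f : continuous f -> (forall x, 0 <= f x) -> has_sup (A f).
Proof.
move=> cf f0; have [M M0 HM] := pseudocompact_bounded pcX cf.
have fM x : f x <= M := le_trans (ler_norm _) (HM x).
by have [] := has_supA f0 fM (ltW M0).
Qed.

Let mu_le f M : continuous f -> (forall x, 0 <= f x) -> (forall x, f x <= M) ->
  0 <= M ->
  mu f <= C * M.
Proof.
move=> cf f0 fM M0; have [[ne _] ub] := has_supA f0 fM M0.
exact: ge_sup.
Qed.

Let mu_ge f g : continuous f -> continuous g -> (forall x, `|g x| <= f x) ->
  `|L g| <= mu f.
Proof.
move=> cf cg gf; have f0 x : 0 <= f x by apply: le_trans (gf x).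
have up := sup_upper_bound (hsA cf f0).
apply/ler_normlP; split.
  rewrite -LN//; apply: up; exists (fun x => - g x); split=> //.
    exact: continuous_fopp.
  by move=> x; rewrite normrN.
by apply: up; exists g.
Qed.

Let mu_mono f g : continuous g -> (forall x, 0 <= f x) ->
  (forall x, f x <= g x) -> mu f <= mu g.
Proof.
move=> cg f0 fg; have g0 x : 0 <= g x := le_trans (f0 x) (fg x).
have up := sup_upper_bound (hsA cg g0).
have sub : A f `<=` A g.
  by move=> _ [u [cu uf ->]]; exists u; split=> // x; exact: le_trans (uf x)
    (fg x).
apply: ge_sup; last by move=> r /sub/up.
exists 0, (fun=> 0); split=> //; first exact: continuous_fcst.
by move=> x; rewrite normr0.
Qed.

Let mu_superadd f g : continuous f -> continuous g -> (forall x, 0 <= f x) ->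
  (forall x, 0 <= g x) -> mu f + mu g <= mu (fun x => f x + g x).
Proof.
move=> cf cg f0 g0; have [nef _] := hsA cf f0; have [neg _] := hsA cg g0.
have cfg := continuous_fadd cf cg.
rewrite -lerBrDr; apply: ge_sup => // _ [u [cu uf ->]].
rewrite lerBrDr -lerBrDl; apply: ge_sup => // _ [v [cv vg ->]].
rewrite lerBrDl -L_add//; apply: le_trans (ler_norm _) _; apply: mu_ge => //.
  exact: continuous_fadd.
by move=> x; apply: le_trans (ler_normD _ _) _; exact: lerD.
Qed.

Let mu_subadd f g : continuous f -> continuous g -> (forall x, 0 <= f x) ->
  (forall x, 0 <= g x) -> mu (fun x => f x + g x) <= mu f + mu g.
Proof.
move=> cf cg f0 g0.
have cfg := continuous_fadd cf cg.
have [ne _] := hsA cfg (fun x => addr_ge0 (f0 x) (g0 x)).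
apply: ge_sup => // _ [u [cu ufg ->]].
(* Riesz decomposition: [u1] clamps [u] between [- f] and [f], and the remainder is bounded by
   [g]. *)
pose u1 x := Num.max (- f x) (Num.min (f x) (u x)).
have c1 : continuous u1 := continuous_fmax (continuous_fopp cf)
  (continuous_fmin cf cu).
have c2 : continuous (fun x => u x - u1 x) := continuous_fsub cu c1.
have -> : u = fun x => u1 x + (u x - u1 x) by apply/funext => x;
  rewrite addrC subrK.
have bnd x : `|u1 x| <= f x /\ `|u x - u1 x| <= g x.
  have := ufg x; have := f0 x; have := g0 x; rewrite /u1 !ler_norml.
  case: (leP (f x) (u x)) => ?.
    by case: (leP (- f x) (f x)) => ? ? ? /andP[? ?]; split; apply/andP; split;
      lra.
  by case: (leP (- f x) (u x)) => ? ? ? /andP[? ?]; split; apply/andP; split;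
    lra.
rewrite L_add//; apply: lerD; apply: le_trans (ler_norm _) _;
  apply: mu_ge => // x.
  by have [] := bnd x.
by have [] := bnd x.
Qed.

(** The maxima [h i k] of [v i], ..., [v (i + k)] have bounded variation [mu], so some
    [k i = h i (m i)] almost attains the supremum over the block lengths. The minima [K n] of [k 0],
    ..., [k n] decrease to 0, uniformly by Dini, while replacing [v n] by its minimum with [K n]
    costs less than [e / 2] in [mu]. *)
Lemma bounded_convergence (u : nat -> X -> R) M e : 0 < e -> 0 <= M ->
  (forall n, continuous (u n)) -> (forall n x, `|u n x| <= M) ->
  (forall x, u n x @[n --> \oo] --> 0) -> exists n, `|L (u n)| < e.
Proof.
move=> e0 M0 cu uM u0; apply: contrapT => H.
have {H} Lu n : e <= `|L (u n)| by rewrite leNgt; apply/negP => lt; apply: H;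
  exists n.
pose v n x := `|u n x|.
pose h i := fix h k x := if k is k'.+1 then Num.max (h k' x) (v (i + k'.+1)%N
  x) else v i x.
have hS i k x : h i k.+1 x = Num.max (h i k x) (v (i + k.+1)%N x) by [].
have cv n : continuous (v n) by move=> x; apply: cvg_norm; exact: cu.
have ch i k : continuous (h i k).
  by elim: k => [|k IH]; [exact: cv|exact: continuous_fmax].
have h0 i k x : 0 <= h i k x.
  by elim: k => [|k IH]; [exact: normr_ge0|rewrite hS le_max IH].
have hM i k x : h i k x <= M.
  by elim: k => [|k IH]; [exact: uM|rewrite hS ge_max IH uM].
have hmono i k k' x : (k <= k')%N -> h i k x <= h i k' x.
  move=> /subnK <-; elim: (k' - k)%N => [//|j IH].
  by rewrite addSn hS le_max IH.
have vh i k x : v (i + k)%N x <= h i k x.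
  by case: k => [|k]; [rewrite addn0|rewrite hS le_max lexx orbT].
pose eps n := e / 2 * (1 / 2) ^+ n.+1.
have eps0 n : 0 < eps n by apply: mulr_gt0; [apply: divr_gt0|apply: exprn_gt0;
  apply: divr_gt0].
have Hm i : exists m, forall k, mu (h i k) <= mu (h i m) + eps i.
  pose B := [set mu (h i k) | k in [set: nat]].
  have hsB : has_sup B.
    split; first by exists (mu (h i 0%N)), 0%N.
    by exists (C * M) => _ [k _ <-]; apply: mu_le.
  have [_ [m _ <-] Bm] := sup_adherent (eps0 i) hsB.
  exists m => k; rewrite -lerBlDr; apply: ltW; apply: le_lt_trans Bm.
  by rewrite lerD2r; apply: sup_upper_bound => //; exists k.
have [m Hm'] := choice Hm.
pose k n := h n (m n).
pose K := fix K n x := if n is n'.+1 then Num.min (k n'.+1 x) (K n' x) else k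
  0%N x.
have cK n : continuous (K n).
  by elim: n => [|n IH]; [exact: ch|exact: (continuous_fmin (ch _ _))].
have K0 n x : 0 <= K n x.
  by elim: n => [|n IH] /=; [exact: h0|rewrite le_min IH h0].
have Kk n x : K n x <= k n x by case: n => [//|n] /=; rewrite ge_min lexx.
(* The excess [r] of [w] over [k n] satisfies [r + k n = max w (k n)], which lies below a longer
   block maximum. As [k n] is almost optimal, superadditivity leaves at most [eps n] for [mu r]. *)
have cut n (w : X -> R) : continuous w -> (forall x, 0 <= w x) ->
  (exists j, forall x, w x <= h n j x) ->
    mu w <= mu (fun x => Num.min (w x) (k n x)) + eps n.
  move=> cw w0 [j wj].
  pose r x := Num.max (w x) (k n x) - k n x.
  have cr : continuous r := continuous_fsub (continuous_fmax cw (ch n (m n)))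
    (ch n (m n)).
  have r0 x : 0 <= r x by rewrite subr_ge0 le_max lexx orbT.
  have min0 x : 0 <= Num.min (w x) (k n x) by rewrite le_min w0 h0.
  have wE : w = fun x => Num.min (w x) (k n x) + r x.
    apply/funext => x; rewrite /r; case: (leP (w x) (k n x)) => wk.
      by rewrite subrr addr0.
    by rewrite addrC subrK.
  rewrite {1}wE; apply: le_trans (mu_subadd (continuous_fmin cw (ch n (m n)))
    cr min0 r0) _.
  rewrite lerD2l -(lerD2r (mu (k n))).
  apply: le_trans (mu_superadd cr (ch n (m n)) r0 (h0 n (m n))) _.
  rewrite [leRHS]addrC; apply: le_trans (Hm' n (maxn j (m n))).
  apply: mu_mono => // x; first by apply: addr_ge0.
  rewrite subrK ge_max; apply/andP; split.
    by apply: le_trans (wj x) (hmono _ _ _ _ _); exact: leq_maxl.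
  by apply: hmono; exact: leq_maxr.
have claim n (w : X -> R) : continuous w -> (forall x, 0 <= w x) ->
    (forall i, (i <= n)%N -> exists j, forall x, w x <= h i j x) ->
    mu w <= mu (fun x => Num.min (w x) (K n x)) + e / 2 * (1 - (1 / 2) ^+ n.+1).
  elim: n w => [|n IH] w cw w0 wh.
    apply: le_trans (cut 0%N w cw w0 (wh 0%N isT)) _; rewrite lerD2l /eps
      expr1; lra.
  apply: le_trans (cut n.+1 w cw w0 (wh n.+1 (leqnn _))) _.
  have w'0 x : 0 <= Num.min (w x) (k n.+1 x) by rewrite le_min w0 h0.
  have := IH (fun x => Num.min (w x) (k n.+1 x)) (continuous_fmin cw (ch _ _))
    w'0.
  have -> : (fun x => Num.min (Num.min (w x) (k n.+1 x)) (K n x)) =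
    (fun x => Num.min (w x) (K n.+1 x)) by apply/funext => x; rewrite /= minA.
  move=> IHw.
  have wh' i : (i <= n)%N -> exists j, forall x, Num.min (w x) (k n.+1 x) <= h
    i j x.
    move=> ilen; have [j Hj] := wh i (leqW ilen); exists j => x.
    by apply: le_trans (Hj x); rewrite ge_min lexx.
  have := IHw wh'; rewrite /eps (exprS _ n.+1); move: (_ ^+ n.+1) => q; lra.
(* A bound [C <= 0] would give [mu (v 0) <= 0], although [mu (v 0)] is at least [e]; afterwards
   division by [C] is possible. *)
have [C0|C0] := leP C 0.
  have := Lu 0%N; have := mu_ge (cv 0%N) (cu 0%N) (fun x => lexx _).
  have := mu_le (cv 0%N) (fun x => normr_ge0 _) (uM 0%N) M0.
  have := mulr_le0_ge0 C0 M0; move: e0; lra.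
have d0 : 0 < e / 4 / C by apply: divr_gt0 => //; apply: divr_gt0.
have [n Kn] : exists n, forall x, K n x <= e / 4 / C.
  apply: Dini => // [n x|x]; first by rewrite /= ge_min lexx orbT.
  have /cvgrPdistC_lt/(_ _ d0)[N _ HN] := u0 x.
  exists N; apply: le_lt_trans (Kk N x) _; rewrite /k.
  elim: (m N) => [|j IH]; first by have := HN N (leqnn N); rewrite /= subr0.
  by rewrite hS gt_max IH; have := HN (N + j.+1)%N (leq_addr _ _);
    rewrite /= subr0.
have := claim n (v n) (cv n) (fun x => normr_ge0 _).
have H2 : mu (fun x => Num.min (v n x) (K n x)) <= C * (e / 4 / C).
  apply: mu_le; first exact: continuous_fmin.
  - by move=> x; rewrite le_min K0 normr_ge0.
  - by move=> x; rewrite ge_min Kn orbT.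
  - exact: ltW.
have H1 := le_trans (Lu n) (mu_ge (cv n) (cu n) (fun x => lexx _)).
have q0 : 0 < (1 / 2 : R) ^+ n.+1 by apply: exprn_gt0; apply: divr_gt0.
rewrite mulrC divfK ?gt_eqF// in H2.
have wh i : (i <= n)%N -> exists j, forall x, v n x <= h i j x.
  by move=> ilen; exists (n - i)%N => x; have := vh i (n - i)%N x;
    rewrite subnKC.
move=> /(_ wh); move: (_ ^+ n.+1) q0 => q q0; nra.
Qed.

End BoundedConvergence.

(** * The Banach space of continuous functions *)

(* The Banach space C(X) of a pseudocompact X; the proof of pseudocompactness is
   kept in the type because it makes the supremum norm finite. *)
Definition Cb (R : realType) (X : topologicalType) (pcX : pseudocompact R X) :
  Type :=
  continuousType X R.

Section BanachC.
Variables (R : realType) (X : topologicalType) (pcX : pseudocompact R X).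
Notation E := (Cb pcX).

HB.instance Definition _ := gen_eqMixin E.
HB.instance Definition _ := gen_choiceMixin E.

Definition Cb_fun (f : E) : X -> R := (f : continuousType X R).
Definition mkCb (f : X -> R) (cf : continuous f) : E := mkcts cf.

Lemma Cb_fun_continuous (f : E) : continuous (Cb_fun f).
Proof. exact: cts_fun. Qed.

Lemma Cb_ext (f g : E) : (forall x, Cb_fun f x = Cb_fun g x) -> f = g.
Proof. by move=> H; apply/continuousEP. Qed.

Let zero : E := mkCb (@continuous_fcst R X 0).
Let opp (f : E) : E := mkCb (continuous_fopp (@Cb_fun_continuous f)).
Let add (f g : E) : E :=
  mkCb (continuous_fadd (@Cb_fun_continuous f) (@Cb_fun_continuous g)).

Let addA : associative add. Proof. by move=> f g h; apply: Cb_ext => x;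
  exact: addrA. Qed.
Let addC : commutative add. Proof. by move=> f g; apply: Cb_ext => x;
  exact: addrC. Qed.
Let add0 : left_id zero add. Proof. by move=> f; apply: Cb_ext => x;
  exact: add0r. Qed.
Let addN : left_inverse zero opp add. Proof. by move=> f; apply: Cb_ext => x;
  exact: addNr. Qed.

HB.instance Definition _ := GRing.isZmodule.Build E addA addC add0 addN.

Lemma continuous_fscale (a : R) (f : X -> R) : continuous f ->
  continuous (fun x => a * f x).
Proof. by move=> cf x; apply: cvgM; [exact: cvg_cst|exact: cf]. Qed.

Let scale (a : R) (f : E) : E :=
  mkCb (@continuous_fscale a _ (@Cb_fun_continuous f)).

Let scaleA a b v : scale a (scale b v) = scale (a * b) v.
Proof. by apply: Cb_ext => x; exact: mulrA. Qed.
Let scale1 : left_id 1 scale. Proof. by move=> f; apply: Cb_ext => x;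
  exact: mul1r. Qed.
Let scaleDr : right_distributive scale +%R.
Proof. by move=> a f g; apply: Cb_ext => x; exact: mulrDr. Qed.
Let scaleDl v : {morph scale^~ v: a b / a + b}.
Proof. by move=> a b; apply: Cb_ext => x; exact: mulrDl. Qed.

HB.instance Definition _ :=
  GRing.Zmodule_isLmodule.Build R E scaleA scale1 scaleDr scaleDl.

Lemma Cb_funD (f g : E) x : Cb_fun (f + g) x = Cb_fun f x + Cb_fun g x. Proof.
  by []. Qed.
Lemma Cb_funN (f : E) x : Cb_fun (- f) x = - Cb_fun f x. Proof. by []. Qed.
Lemma Cb_funZ a (f : E) x : Cb_fun (a *: f) x = a * Cb_fun f x. Proof. by [].
  Qed.

Let norm (f : E) : R := sup [set `|Cb_fun f x| | x in [set: X]].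

Let le_norm (f : E) x : `|Cb_fun f x| <= norm f.
Proof.
have [M _ HM] := pseudocompact_bounded pcX (@Cb_fun_continuous f).
apply: sup_upper_bound; last by exists x.
by split; [exists `|Cb_fun f x|, x|exists M => _ [y _ <-]].
Qed.

Let norm_le (f : E) M : 0 <= M -> (forall x, `|Cb_fun f x| <= M) -> norm f <= M.
Proof.
move=> M0 HM; rewrite /norm; set A := [set _ | _ in _].
have [->|/set0P A0] := eqVneq A set0; first by rewrite sup0.
by apply: ge_sup => // _ [x _ <-].
Qed.

Let norm_ge0 (f : E) : 0 <= norm f.
Proof.
(* [X] may be empty; the norm is then the supremum of the empty set, which is 0. *)
have [[x _]|nX] := pselect (exists x : X, True); first by apply: le_trans
  (le_norm f x).
rewrite /norm (_ : [set _ | _ in _] = set0) ?sup0//.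
by apply/seteqP; split=> // r [x _ _]; apply: nX; exists x.
Qed.

Let normD (f g : E) : norm (f + g) <= norm f + norm g.
Proof.
apply: norm_le => [|x]; first exact: addr_ge0.
by rewrite Cb_funD; apply: le_trans (ler_normD _ _) (lerD _ _).
Qed.

Let normZ (a : R) (f : E) : norm (a *: f) = `|a| * norm f.
Proof.
have le b g : norm (b *: g) <= `|b| * norm g.
  apply: norm_le => [|x]; first exact: mulr_ge0.
  by rewrite Cb_funZ normrM ler_wpM2l.
apply/eqP; rewrite eq_le le /=; have [->|a0] := eqVneq a 0.
  by rewrite normr0 mul0r.
rewrite -ler_pdivlMl ?normr_gt0// -normfV; apply: le_trans (le _ _).
by rewrite scalerA mulVf// scale1r.
Qed.

Let norm0 (f : E) : norm f = 0 -> f = 0.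
Proof.
move=> f0; apply: Cb_ext => x; apply/eqP; rewrite -normr_le0 -f0.
exact: le_norm.
Qed.

HB.instance Definition _ := Lmodule_isNormed.Build R E normD normZ norm0.

Lemma Cb_norm_ge (f : E) x : `|Cb_fun f x| <= `|f|. Proof. exact: le_norm. Qed.

Lemma Cb_norm_le (f : E) M : 0 <= M -> (forall x, `|Cb_fun f x| <= M) ->
  `|f| <= M.
Proof. exact: norm_le. Qed.

Let complete (F : set_system E) : ProperFilter F -> cauchy F -> cvg F.
Proof.
move=> FF /cauchyP Fc.
have near (e : R) : 0 < e -> exists f : E, F [set g : E | forall x,
  `|Cb_fun g x - Cb_fun f x| <= e].
  move=> e0; have [f Ff] := Fc _ e0; exists f; apply: filterS Ff => g.
  rewrite -ball_normE /= distrC => fg x; apply: le_trans (ltW fg).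
  exact: (Cb_norm_ge (g - f) x).
have lim x : exists l : R, Cb_fun f x @[f --> F] --> l.
  apply/cvg_ex; apply: R_complete; apply/cauchy_exP => e e0.
  have e20 : 0 < e / 2 by apply: divr_gt0.
  have [f Ff] := near _ e20; exists (Cb_fun f x).
  suff : F [set g : E | `|Cb_fun f x - Cb_fun g x| < e] by [].
  apply: filterS Ff => g fg /=; rewrite distrC; apply: le_lt_trans (fg x) _.
  by rewrite ltr_pdivrMr// ltr_pMr// ltr1n.
have [h Fh] := choice lim.
have hf (e : R) : 0 < e -> exists f : E, F [set g : E | forall x,
  `|Cb_fun g x - Cb_fun f x| <= e] /\
    forall x, `|h x - Cb_fun f x| <= e.
  move=> e0; have [f Ff] := near e e0; exists f; split=> // x.
  apply/ler_addgt0Pr => d d0; have /cvgrPdist_lt/(_ _ d0) Fd := Fh x.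
  have [g [/= hg gf]] := filter_ex (filterI Fd Ff).
  have := ltW hg; have := gf x; rewrite !ler_norml.
  by move=> /andP[? ?] /andP[? ?]; apply/andP; split; lra.
have ch : continuous h.
  apply: continuous_nearP => x e e0; have e30 : 0 < e / 3 by apply: divr_gt0.
  have [f [_ Hf]] := hf _ e30.
  have := @Cb_fun_continuous f x => /cvgrPdistC_lt/(_ _ e30); apply: filterS =>
    y fy.
  have := Hf x; have := Hf y; move: fy; rewrite ltr_norml !ler_norml.
  by move=> /andP[? ?] /andP[? ?] /andP[? ?]; apply/andP; split; lra.
apply/cvg_ex; exists (mkCb ch); apply/cvgrPdist_le => e e0.
have e20 : 0 < e / 2 by apply: divr_gt0.
have [f [Ff Hf]] := hf _ e20; apply: filterS Ff => g Hg.
apply: Cb_norm_le (ltW e0) _ => x.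
have -> : Cb_fun (mkCb ch - g) x = h x - Cb_fun g x by [].
have := Hf x; have := Hg x; rewrite !ler_norml.
by move=> /andP[? ?] /andP[? ?]; apply/andP; split; lra.
Qed.

HB.instance Definition _ := Uniform_isComplete.Build E complete.

End BanachC.

(** * Bounded linear functionals on C(X) *)

Section Eberlein.
Variables (R : realType) (X : topologicalType).
Hypotheses (tX : tychonoff_space X) (pcX : pseudocompact R X).
Notation E := (Cb pcX).

Lemma dual_bounded (l : {linear E -> R^o}) : continuous l ->
  exists C : R, forall f : E, `|l f| <= C * `|f|.
Proof.
move=> cl; have [C HC] : exists C, forall f : E, `|f| <= 1 -> `|l f| <= C.
  have /cvgrPdist_lt/(_ 1 ltr01) := cl 0; rewrite linear0.
  move=> /nbhs_ballP[d /= d0 Hd]; exists (2 / d) => f f1.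
  have d20 : 0 < d / 2 by apply: divr_gt0.
  have E1 : `|(d / 2) *: f| = d / 2 * `|f| by rewrite normrZ gtr0_norm.
  have E2 : `|l ((d / 2) *: f)| = d / 2 * `|l f|.
    by rewrite linearZ /= [LHS]normrM gtr0_norm.
  have := Hd ((d / 2) *: f); rewrite -ball_normE /= !sub0r !normrN E1 E2 => H.
  have {H} : d / 2 * `|l f| < 1 by apply: H; nra.
  by rewrite -ltr_pdivlMl// mulr1 invf_div; exact: ltW.
exists C => f; have [->|f0] := eqVneq f 0.
  by rewrite linear0 !normr0 mulr0.
have f0' : 0 < `|f|^-1 by rewrite invr_gt0 normr_gt0.
have E1 : `| `|f|^-1 *: f | = 1 by rewrite normrZ gtr0_norm// mulVf// normr_eq0.
have E2 : `|l (`|f|^-1 *: f)| = `|f|^-1 * `|l f|.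
  by rewrite linearZ /= [LHS]normrM gtr0_norm.
have := HC (`|f|^-1 *: f); rewrite E1 E2 => /(_ (lexx _)).
by rewrite ler_pdivrMl ?normr_gt0// mulrC.
Qed.

Let C (f : X -> R) (cf : continuous f) : E := mkCb pcX cf.

Lemma dual_bounded_convergence (l : {linear E -> R^o}) (u : nat -> E)
    (M e : R) :
  continuous l -> 0 < e -> 0 <= M -> (forall n x, `|Cb_fun (u n) x| <= M) ->
  (forall x, Cb_fun (u n) x @[n --> \oo] --> 0) -> exists n, `|l (u n)| < e.
Proof.
move=> cl e0 M0 uM u0; have [K HK] := dual_bounded cl.
(* Bounded convergence is stated for functionals on all functions; the value 0 at discontinuous ones
   is arbitrary, since its hypotheses concern continuous functions only. *)
pose L (f : X -> R) : R := if pselect (continuous f) is left cf then l (C cf)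
  else 0.
have LE (f : X -> R) (cf : continuous f) : L f = l (C cf).
  rewrite /L; case: pselect => // cf'; congr (l _).
  exact: Cb_ext.
have uE n : L (Cb_fun (u n)) = l (u n).
  by rewrite (LE _ (@Cb_fun_continuous _ _ _ (u n))); congr (l _);
    exact: Cb_ext.
have L_add f g : continuous f -> continuous g -> L (fun x => f x + g x) = L f +
  L g.
  move=> cf cg; rewrite (LE _ cf) (LE _ cg) (LE _ (continuous_fadd cf cg))
    -linearD.
  by congr (l _); exact: Cb_ext.
have L_bound f N : continuous f -> (forall x, `|f x| <= N) -> 0 <= N ->
  L f <= `|K| * N.
  move=> cf fN N0; rewrite (LE _ cf); apply: le_trans (ler_norm _) _.
  apply: le_trans (HK _) _; apply: (@le_trans _ _ (`|K| * `|C cf|)).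
    by apply: ler_wpM2r => //; exact: ler_norm.
  by apply: ler_wpM2l => //; exact: Cb_norm_le.
have [n] := bounded_convergence tX pcX L_add L_bound e0 M0
  (fun n => @Cb_fun_continuous _ _ _ (u n)) uM u0.
by rewrite uE; exists n.
Qed.

(** Evaluations are bounded functionals, so weak convergence implies pointwise convergence; this
    makes the inverse of the embedding [theta] continuous. *)
Lemma eval_dual x : exists l : dual_space E, forall f, sval l f = Cb_fun f x.
Proof.
have lin : GRing.linear_for *:%R ((fun f : E => Cb_fun f x) : E -> R^o) by [].
pose l : {linear E -> R^o} := HB.pack ((fun f : E => Cb_fun f x) : E -> R^o)
  (GRing.isLinear.Build R E R^o *:%R _ lin).
have cl : continuous l.
  move=> f; have FF : Filter (nbhs f) by exact: nbhs_filter.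
  apply/cvgrPdist_le => e e0.
  apply: (@filterS _ (nbhs f) FF (ball f e)); last exact: nbhsx_ballx.
  move=> g; rewrite -ball_normE /= => fg; apply: le_trans (ltW fg).
  exact: (Cb_norm_ge (f - g) x).
by exists (exist _ l cl).
Qed.

End Eberlein.

(** * A homeomorphism of the reals onto ]-1, 1[ *)

Section Squash.
Variable R : realType.

Definition squash (t : R) : R := t / (1 + `|t|).
Definition unsquash (s : R) : R := s / (1 - `|s|).

Lemma squash_lt1 t : `|squash t| < 1.
Proof.
rewrite /squash normrM normfV (gtr0_norm (x := 1 + _)) ?ltr_wpDr//.
by rewrite ltr_pdivrMr ?ltr_wpDr// mul1r ltrDr.
Qed.

Lemma squashK : cancel squash unsquash.
Proof.
move=> t; have t1 : 0 < 1 + `|t| by rewrite ltr_wpDr.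
rewrite /unsquash /squash normrM normfV (gtr0_norm t1).
have -> : 1 - `|t| / (1 + `|t|) = (1 + `|t|)^-1.
  by rewrite -[X in X - _](divff (lt0r_neq0 t1)) -mulrBl addrK mul1r.
by rewrite invrK divfK// lt0r_neq0.
Qed.

Lemma squash_continuous : continuous squash.
Proof.
move=> t; apply: cvgM; first exact: cvg_id.
apply: cvgV; first by rewrite lt0r_neq0// ltr_wpDr.
by apply: cvgD; [exact: cvg_cst|apply: cvg_norm; exact: cvg_id].
Qed.

Lemma unsquash_continuous s : `|s| < 1 -> {for s, continuous unsquash}.
Proof.
move=> s1; apply: cvgM; first exact: cvg_id.
apply: cvgV; first by rewrite lt0r_neq0// subr_gt0.
by apply: cvgB; [exact: cvg_cst|apply: cvg_norm; exact: cvg_id].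
Qed.

End Squash.

(** * Compact subsets of [Cp R X] are Eberlein compacta *)

Section CompactEberlein.
Variables (R : realType) (X : topologicalType).
Hypotheses (tX : tychonoff_space X) (pcX : pseudocompact R X).
Variable Y : set (Cp R X).
Hypothesis cY : compact Y.
Notation E := (Cb pcX).

Let cYT : compact [set: set_type Y]. Proof. exact: (compact_setT Y).1. Qed.
Let pcY : pseudocompact R (set_type Y). Proof. exact: compact_pseudocompact.
  Qed.
Let sY := eval_on_sep Y.

Let limC : continuous_limits (@eval_on R X Y).
Proof. by move=> h /(compact_pointwise_limit cYT sY.1)[f ->]; exact: sY.2. Qed.

(* Squashing makes [Y] uniformly bounded without changing its topology. *)
Let theta (f : set_type Y) : E :=
  mkCb pcX (fun x => continuous_comp (sY.2 f x) (@squash_continuous R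
    (eval_on x f))).

Let thetaE f x : Cb_fun (theta f) x = squash (eval_on x f). Proof. by []. Qed.

(** At a discontinuity [f0] some sequence in the bad set [D] converges pointwise to [f0]. The
    squashed differences are bounded by 2 and tend to 0, so bounded convergence contradicts the
    membership in [D]. *)
Let theta_dual (l : dual_space E) : continuous (fun f => sval l (theta f) : R).
Proof.
case: l => l cl /=; apply: contrapT => /not_continuousP[f0 [e [e0 He]]].
pose D := [set f | e < `|(l (theta f) : R) - l (theta f0)|].
have f0D : pointwise_limit (@eval_on R X Y) D (fun x : X => eval_on x f0).
  move=> s d d0; have n0 : nbhs f0 [set g : set_type Y |
      forall x, x \in s -> `|eval_on x g - eval_on x f0| < d].
    apply: filter_forall_in => x _; apply: open_nbhs_nbhs; split.
      by apply: open_dist_lt; exact: sY.1.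
    by rewrite /= subrr normr0.
  by have [g Hg Dg] := He _ n0; exists g.
have [||f Df ff0] := pointwise_limit_seq tX pcX sY (D := D) _ _ f0D.
- by move=> x; have [M HM] := pseudocompact_Cp_bounded pcY x; exists M.
- by move=> h /(pointwise_limitS (@subsetT _ _)); exact: limC.
have [||n] := dual_bounded_convergence tX cl e0 (ler0n R 2)
    (u := fun n => theta (f n) - theta f0).
- move=> n x; rewrite Cb_funD Cb_funN !thetaE; apply: le_trans (ler_normB _ _)
  _.
  by apply: ltW; rewrite [ltRHS](_ : _ = 1 + 1)// ltrD ?squash_lt1.
- move=> x; rewrite -(subrr (squash (eval_on x f0))).
  apply: cvgB; last exact: cvg_cst.
  by apply: cvg_comp (ff0 x) _; exact: squash_continuous.
by rewrite linearB ltNge (ltW (Df n)).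
Qed.

Lemma compact_eberlein : eberlein_compactum R (set_type Y).
Proof.
split=> //; exists E, (range (theta : set_type Y -> weak_space E)).
have ctheta : continuous (theta : set_type Y -> weak_space E).
  move=> f; have FF : Filter (nbhs f) by exact: nbhs_filter.
  by apply/initial_cvgP; apply/ptws_cvgP => l; exact: theta_dual.
split.
  by apply: continuous_compact cYT; exact: continuous_subspaceT.
pose F f : set_type (range (theta : set_type Y -> weak_space E)) :=
  exist _ (theta f) (mem_set (imageT theta f)).
have surj (k : set_type (range (theta : set_type Y -> weak_space E))) :
    exists f, theta f = \val k.
  by have [f _ fk] := set_valP k; exists f.
have [G HG] := choice surj.
have GE k x : eval_on x (G k) = unsquash (Cb_fun (\val k : E) x).
  by rewrite -HG thetaE squashK.
exists F, G; split.
- by apply: continuous_comp_initial => f; exact: ctheta.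
- move=> k; have FF : Filter (nbhs k) by exact: nbhs_filter.
  apply/set_Cp_cvgP => x.
  have [l Hl] := eval_dual pcX x.
  have ck : Cb_fun (\val j : E) x @[j --> k] --> Cb_fun (\val k : E) x.
    rewrite -Hl (_ : (fun j => Cb_fun (\val j : E) x) = fun j =>
      sval l (\val j)).
      have k1 : (\val j : weak_space E) @[j --> k] --> (\val k : weak_space E).
        exact: (@initial_continuous _ (weak_space E) set_val k).
      by move/initial_cvgP/ptws_cvgP: k1; apply.
    by apply/funext => j; rewrite Hl.
  rewrite -/(eval_on x (G k)) GE.
  suff H : (fun j => eval_on x (G j)) j @[j --> k] -->
    unsquash (Cb_fun (\val k : E) x).
    exact: H.
  have -> : (fun j => eval_on x (G j)) = @unsquash R \o (fun j =>
    Cb_fun (\val j : E) x).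
    by apply/funext => j; rewrite /= -GE.
  apply: cvg_comp ck _; apply: unsquash_continuous.
  by rewrite -HG thetaE squash_lt1.
- move=> f; apply: val_inj; apply/continuousEP => x.
  by rewrite -!/(eval_on x _) GE thetaE squashK.
- by move=> k; apply: val_inj; rewrite /= HG.
Qed.

End CompactEberlein.

(** * Regular closed subspaces and points of countable pi-character *)

Lemma set_type_nbhsP (T : topologicalType) (A : set T) (z : set_type A) (B :
  set (set_type A)) :
  nbhs z B <-> exists2 D, nbhs (\val z) D & forall w : set_type A,
    D (\val w) -> B w.
Proof.
split=> [[_ /= [[D oD <-] Dz] DB]|[D zD DB]].
  by exists D => //; exact: open_nbhs_nbhs.
by apply: filterS DB _; exact: (@initial_continuous _ T set_val z).
Qed.

Section RegularClosed.
Variables (R : realType) (Z : topologicalType) (Y : set Z).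
Hypotheses (tY : tychonoff_space (set_type Y)) (pcY : pseudocompact R
  (set_type Y)).
Variable V : set (set_type Y).
Hypothesis oV : open V.

Let C : set Z := \val @` closure V.

(** Carries open sets of [C] to open sets of [Y] inside the dense part [V]; points of the two
    subspaces are compared in [Z]. *)
Let trace (B : set (set_type C)) : set (set_type Y) :=
  [set t | V t /\ exists2 z : set_type C, \val z = \val t & B z].

Let nbhs_trace (B : set (set_type C)) (z : set_type C) (t : set_type Y) :
  nbhs z B -> \val z = \val t ->
  \forall u \near t, V u -> trace B u.
Proof.
move=> /set_type_nbhsP[D zD DB] zt; apply/set_type_nbhsP; exists D;
  first by rewrite -zt.
move=> u Du Vu; split=> //.
have Cu : C (\val u) by exists u => //; exact: subset_closure.
by exists (exist _ (\val u) (mem_set Cu)) => //; exact: DB.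
Qed.

Let trace_open (B : set (set_type C)) : open B -> open (trace B).
Proof.
move=> oB; rewrite openE => t [Vt [z zt Bz]].
have nV : nbhs t V by apply: open_nbhs_nbhs.
have nB : nbhs z B by apply: open_nbhs_nbhs.
by apply: filterS (filterI nV (nbhs_trace nB zt)) => u [Vu]; exact.
Qed.

Let trace_nonempty (B : set (set_type C)) (z : set_type C) : nbhs z B ->
  trace B !=set0.
Proof.
move=> zB; have [c Vc cz] := set_valP z.
have [u [Vu Bu]] := Vc _ (nbhs_trace zB (esym cz)).
by exists u; exact: Bu.
Qed.

(** For an unbounded [g] the sets where the absolute value of [g] exceeds [n] have nonempty open
    traces in [Y]. These cluster at a point of [closure V], near which [g] is bounded. *)
Lemma regular_closed_pseudocompact : pseudocompact R (set_type C).
Proof.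
move=> g cg; apply: contrapT => ng.
have unb (n : nat) : exists z : set_type C, n%:R < `|g z|.
  apply: contrapT => H; apply: ng; exists n%:R; split; first exact: num_real.
  move=> M nM z _ /=; apply: le_trans (ltW nM); rewrite leNgt; apply/negP => lt.
  by apply: H; exists z.
pose B n := [set z : set_type C | n%:R < `|g z - 0|].
have oB n : open (B n) by apply: open_dist_gt.
have [t Bt] : exists t, cluster_seq (fun n => trace (B n)) t.
  apply: (pseudocompact_cluster_seq tY pcY) => n; first exact: trace_open.
  have [z Bz] := unb n; apply: (@trace_nonempty _ z); apply: open_nbhs_nbhs;
    split=> //.
  by rewrite /B /= subr0.
have Vt : closure V t.
  by apply: (cluster_seq_closed (N := 0%N) Bt (@closed_closure _ V)) =>
    n _ u [Vu _]; exact: subset_closure.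
have Ct : C (\val t) by exists t.
pose z : set_type C := exist _ (\val t) (mem_set Ct).
have nz : nbhs z [set w | `|g w - g z| < 1].
  by apply: open_nbhs_nbhs; split; [exact: open_dist_lt|rewrite /= subrr
    normr0].
have /set_type_nbhsP[D tD DB] := nz.
have nt : nbhs t [set u : set_type Y | D (\val u)] by apply/set_type_nbhsP;
  exists D.
have [n Nn [u [[Vu [w wu Bw]] Du]]] := Bt _ nt (Num.truncn (`|g z| + 1)).+1.
have := DB w; rewrite wu => /(_ Du) /= gw; rewrite /B /= subr0 in Bw.
have := truncnS_gt (`|g z| + 1); have : (Num.truncn (`|g z| + 1)).+1%:R <=
  n%:R :> R by rewrite ler_nat.
have := ler_normD (g w - g z) (g z); rewrite subrK; move: gw Bw; lra.
Qed.

(** The traces of a countable base at [z] are open in [Y], but need not contain the corresponding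
    point [c] of [closure V]; this is why only a pi-base survives. *)
Lemma regular_closed_pi_character : (exists z : set_type C, countable_character
  z) ->
  exists2 c, closure V c & countable_pi_character c.
Proof.
move=> [z [B [cB Bz HB]]]; have [c Vc cz] := set_valP z; exists c => //.
exists [set trace (interior b) | b in B]; split.
- exact: sub_countable (card_image_le _ _) cB.
- move=> _ [b Bb <-]; split; first by apply: trace_open; exact: open_interior.
  by apply: (@trace_nonempty _ z); apply: open_nbhs_nbhs; split;
    [exact: open_interior|exact: Bz].
- move=> U /set_type_nbhsP[D cD DU].
  have zD : nbhs z [set w : set_type C | D (\val w)] by apply/set_type_nbhsP;
    exists D; rewrite -?cz.
  have [b Bb bD] := HB _ zD; exists (trace b°); first by exists b.
  by move=> u [_ [w wu /interior_subset/bD /=]]; rewrite wu; exact: DU.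
Qed.

End RegularClosed.

(** Every nonempty open [O] contains a regular closed set, which is pseudocompact; the pf-property
    yields in it a point of countable character, hence a point of [O] of countable pi-character in
    [Y]. *)
Lemma pf_pi_dense (R : realType) (X : topologicalType) (Y : set (Cp R X)) :
  pf_Grothendieck R X -> pseudocompact R (set_type Y) ->
  dense [set f : set_type Y | countable_pi_character f].
Proof.
move=> pf pcY O [f Of] oO; have tY := set_Cp_tychonoff Y.
have [W fW WO] := completely_regular_regular (R := R) tY.2 (open_nbhs_nbhs
  (conj oO Of)).
have oV := @open_interior _ W.
have Z0 : (\val @` closure W°) !=set0 by exists (\val f), f => //;
  exact: subset_closure.
have [c Vc pic] := regular_closed_pi_character oV
  (pf _ Z0 (regular_closed_pseudocompact tY pcY oV)).
by exists c; split=> //; apply: WO; apply: closureS Vc; exact: interior_subset.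
Qed.

(** * Grothendieck pairs and the Stone-Cech compactification *)

Section GrothendieckPair.
Variables (R : realType) (X Y : topologicalType).

Lemma stone_cech_compact : compact [set: stone_cech R X].
Proof.
apply: (compact_setT _).1.
have cube := @tychonoff (unit_functions R X) (fun=> R : topologicalType)
  (fun=> `[0, 1]%classic) (fun=> @segment_compact R 0 1).
apply: (subclosed_compact _ cube); first exact: closed_closure.
move=> p pcl u.
suff : [set f : {ptws unit_functions R X -> R} | f u \in `[0, 1]] p by [].
have cu := @ptws_eval_continuous (unit_functions R X) R u.
have clu : closed [set f : {ptws unit_functions R X -> R} | f u \in `[0, 1]].
  apply: (@preimage_closed _ _ (fun f : {ptws unit_functions R X -> R} => f u)
    `[0, 1]%classic).
    by move=> f _; exact: cu.
  exact: itv_closed.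
apply: clu; apply: closureS pcl => _ [x _ <-] /=; rewrite in_itv /=.
exact: (svalP u x).
Qed.

(** An extension represents every limit of the functions [Phi x] by a point of the compactification.
    Conversely, each point of the compactification defines such a limit through its coordinates. *)
Lemma Grothendieck_pairP : pseudocompact R X ->
  Grothendieck_pair R X Y <-> forall Phi : X -> Y -> R,
    separately_continuous Phi -> continuous_limits (fun y x => Phi x y).
Proof.
move=> pcX; split=> [GP Phi sPhi k hk|lim Phi sPhi].
  have [Psi [[cPsi1 cPsi2] PsiE]] := GP Phi sPhi.
  have hk' : pointwise_limit (fun y p => Psi p y) setT k.
    move=> s e e0; have [x _ Hx] := hk s e e0; exists (to_stone_cech R x) => //
      y ys.
    by rewrite PsiE; exact: Hx.
  have [p ->] := compact_pointwise_limit stone_cech_compact cPsi2 hk'.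
  exact: cPsi1.
have bnd y : exists M, 0 < M /\ forall x, `|Phi x y| <= M.
  by have [M M0 HM] := pseudocompact_bounded pcX (@sPhi.2 y); exists M.
have [M HM] := choice bnd.
(* Since [Phi ^~ y] has values in [[- M y, M y]], this rescales it into [[0, 1]], where it is a
   coordinate of the cube; [Psi] undoes the rescaling. *)
have cu y : continuous (fun x => (Phi x y + M y) / (2 * M y)).
  move=> x; apply: cvgM; last exact: cvg_cst.
  by apply: cvgD; [exact: sPhi.2|exact: cvg_cst].
have u01 y x : 0 <= mkcts (@cu y) x <= 1.
  have [M0 /(_ x)] := HM y; rewrite ler_norml /mkcts => /andP[h1 h2].
  have M20 : 0 < 2 * M y by apply: mulr_gt0.
  by rewrite divr_ge0 ?(ltW M20)//= ?ler_pdivrMr//; lra.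
pose u y : unit_functions R X := exist _ (mkcts (@cu y) : continuousType X R)
  (u01 y).
pose Psi (p : stone_cech R X) y : R := 2 * M y * (\val p) (u y) - M y.
have PsiE x y : 2 * M y * sval (u y) x - M y = Phi x y.
  have [M0 _] := HM y; rewrite /= /mkcts mulrC divfK ?addrK//.
  by rewrite mulf_neq0// gt_eqF.
exists Psi; split; last by move=> x y; exact: PsiE.
split=> [p|y].
  apply: (lim Phi sPhi) => s e e0.
  have np : nbhs (\val p : {ptws unit_functions R X -> R}) [set g :
    {ptws unit_functions R X -> R} |
      forall y, y \in s -> `|g (u y) - (\val p) (u y)| < e / (2 * M y)].
    apply: filter_forall_in => y _; have [M0 _] := HM y.
    have /ptws_cvgP/(_ (u y))/cvgrPdistC_lt :=
      @cvg_id _ (nbhs (\val p : {ptws unit_functions R X -> R})).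
    by apply; rewrite divr_gt0// mulr_gt0.
  have [_ [[x _ <-] Hx]] := set_valP p _ np.
  exists x => // y ys; have [M0 _] := HM y; have M20 :
    0 < 2 * M y by apply: mulr_gt0.
  have -> : Phi x y - Psi p y = 2 * M y * (sval (u y) x - (\val p) (u y)).
    by rewrite -PsiE /Psi; ring.
  by rewrite normrM (gtr0_norm M20) mulrC -ltr_pdivlMr//; exact: Hx.
have cv : continuous (fun p : stone_cech R X => (\val p) (u y)).
  move=> p; exact: continuous_comp (@initial_continuous (stone_cech R X) _
    set_val p)
    (@ptws_eval_continuous _ _ (u y) (set_val p)).
exact: (continuous_fsub (@continuous_fscale _ _ (2 * M y) _ cv)
  (@continuous_fcst _ _ (M y))).
Qed.

End GrothendieckPair.

(** * Both pair properties expressed by continuity of limits *)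

Definition all_limits_continuous (R : realType) (X Y : topologicalType) :=
  forall Phi : X -> Y -> R, separately_continuous Phi -> continuous_limits Phi.

Section Pairs.
Variables (R : realType) (X Y : topologicalType).
Hypotheses (tX : tychonoff_space X) (pcX : pseudocompact R X).
Hypotheses (tY : tychonoff_space Y) (pcY : pseudocompact R Y).

Lemma all_limits_sym : all_limits_continuous R X Y -> all_limits_continuous R Y
  X.
Proof.
move=> lim Phi sPhi; have sPhi' := sep_sym sPhi.
exact: (limits_sym tX pcX pcY sPhi' (lim _ sPhi')).
Qed.

Lemma Grothendieck_pair_limits : Grothendieck_pair R Y X <->
  all_limits_continuous R X Y.
Proof.
rewrite Grothendieck_pairP//; split=> H Phi sPhi; exact: (H _ (sep_sym sPhi)).
Qed.

Lemma Namioka_limits : Namioka_property R X Y <-> all_limits_continuous R X Y.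
Proof.
split=> [N Phi sPhi|lim Phi sPhi].
  have [D [dD _ HD]] := N Phi sPhi.
  by apply: (locally_joint_limits tX pcX tY pcY sPhi);
    exact: Namioka_locally_joint HD.
have [D [dD GD HD]] := continuous_limits_generic tX pcX tY pcY sPhi
  (lim Phi sPhi).
exists D; split=> // x y Dy; apply/cvgrPdistC_le => e e0.
have e20 : 0 < e / 2 by apply: divr_gt0.
have [W [yW HW]] := HD y Dy _ e20.
have nU : \forall v \near x, `|Phi v y - Phi x y| < e / 2.
  by have /cvgrPdistC_lt/(_ _ e20) := @sPhi.2 y x.
exists ([set v | `|Phi v y - Phi x y| < e / 2], W) => // -[v w] [/= vU wW].
rewrite -(subrK (Phi v y) (Phi v w)) -addrA [leRHS]splitr.
by apply: le_trans (ler_normD _ _) _; apply: lerD (HW v w wW) (ltW vU).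
Qed.

End Pairs.

(** * The equivalences *)

Section Equivalences.
Variables (R : realType) (X : topologicalType).
Hypotheses (tX : tychonoff_space X) (pcX : pseudocompact R X).

Lemma dense_subset (T : topologicalType) (A B : set T) : A `<=` B -> dense A ->
  dense B.
Proof. by move=> AB dA O O0 oO; have [x [Ox Ax]] := dA O O0 oO; exists x;
  split=> //; exact: AB. Qed.

Lemma subspace_equivalences (Y : set (Cp R X)) : pseudocompact R (set_type Y) ->
  [<-> compact (closure Y);
       compact Y;
       eberlein_compactum R (set_type Y);
       weakly_pc_Grothendieck R (set_type Y);
       dense [set f : set_type Y | pointwise_uniform_coincide f];
       dense [set f : set_type Y | countable_character f];
       dense [set f : set_type Y | countable_pi_character f]].
Proof.
move=> pcY; have tY := set_Cp_tychonoff Y; have sY := eval_on_sep Y.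
tfae.
- by move=> /(compact_closure_limits pcY); exact: limits_compact.
- exact: compact_eberlein.
- by move=> [cY _]; exact: compact_weakly_pc.
- by move=> wY; apply: limits_coincide_dense => //; exact: weakly_pc_limits.
- by apply: dense_subset => f; exact: coincide_countable_character.
- by apply: dense_subset => f; exact: countable_character_pi.
- move=> piY; apply/(compact_closure_limits pcY).
  apply: (locally_joint_limits tX pcX tY pcY sY).
  exact: (countable_pi_character_joint tX pcX tY pcY sY).
Qed.

Lemma pair_equivalences (Y : topologicalType) : tychonoff_space Y ->
  pseudocompact R Y ->
  [<-> Grothendieck_pair R X Y;
       Grothendieck_pair R Y X;
       Namioka_property R X Y;
       Namioka_property R Y X].
Proof.
move=> tY pcY; tfae.
- move=> /(Grothendieck_pair_limits _ pcX) H.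
  by apply/(Grothendieck_pair_limits _ pcY); exact: all_limits_sym H.
- move=> /(Grothendieck_pair_limits _ pcY) H.
  exact/(Namioka_limits tX pcX tY pcY).
- move=> /(Namioka_limits tX pcX tY pcY) H.
  by apply/(Namioka_limits tY pcY tX pcX); exact: all_limits_sym H.
- move=> /(Namioka_limits tY pcY tX pcX) H.
  exact/(Grothendieck_pair_limits _ pcX).
Qed.

End Equivalences.

Theorem theorem3 (R : realType) (X : topologicalType)
    (tychonoffX : tychonoff_space X) (pseudocompactX : pseudocompact R X) :
  [/\ forall Y : set (Cp R X), pseudocompact R (set_type Y) ->
        [<-> compact (closure Y);
             compact Y;
             eberlein_compactum R (set_type Y);
             weakly_pc_Grothendieck R (set_type Y);
             dense [set f : set_type Y | pointwise_uniform_coincide f];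
             dense [set f : set_type Y | countable_character f];
             dense [set f : set_type Y | countable_pi_character f]],
      forall Y : topologicalType, tychonoff_space Y -> pseudocompact R Y ->
        [<-> Grothendieck_pair R X Y;
             Grothendieck_pair R Y X;
             Namioka_property R X Y;
             Namioka_property R Y X]
    & [<-> weakly_pc_Grothendieck R X;
           pc_Grothendieck R X;
           pe_Grothendieck R X;
           pf_Grothendieck R X;
           forall Y : set (Cp R X), pseudocompact R (set_type Y) ->
             compact (closure Y) \/
             compact Y \/
             eberlein_compactum R (set_type Y) \/
             weakly_pc_Grothendieck R (set_type Y) \/
             dense [set f : set_type Y | pointwise_uniform_coincide f] \/
             dense [set f : set_type Y | countable_character f] \/
             dense [set f : set_type Y | countable_pi_character f];
           forall Y : topologicalType, tychonoff_space Y -> pseudocompact R Y ->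
             Grothendieck_pair R X Y \/
             Grothendieck_pair R Y X \/
             Namioka_property R X Y \/
             Namioka_property R Y X]].
Proof.
have sub := subspace_equivalences tychonoffX pseudocompactX.
have pair := pair_equivalences tychonoffX pseudocompactX.
split=> //; tfae.
- by move=> wX Y pcY; apply: (sub Y pcY 0%N 1%N).1; exact: wX.
- by move=> cX Y pcY; apply: (sub Y pcY 1%N 2%N).1; exact: cX.
- move=> eX Y [y Yy] pcY; have dY := (sub Y pcY 2%N 5%N).1 (eX Y pcY).
  have [|f [_ Hf]] := dY setT _ openT; last by exists f.
  by exists (exist _ y (mem_set Yy)).
- by move=> pf Y pcY; do 6 right; exact: pf_pi_dense.
(* From subspaces to pairs: the hypothesis is applied to the image [Z] of [Y] in [Cp R X], and each
   alternative for [Z] yields that its closure is compact. *)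
- move=> H Y tY pcY; right; left; apply/Grothendieck_pair_limits => // Phi sPhi.
  apply: (compact_image_limits (sPhi := sPhi)) => //.
  set Z := (X in closure X); have pcZ : pseudocompact R (set_type Z).
    exact: pseudocompact_image (@continuous_Cp_map _ _ _ _ sPhi) pcY.
  have e := sub Z pcZ.
  case: (H Z pcZ) => [//|[|[|[|[|[|]]]]]].
  + exact: (e 1%N 0%N).1.
  + exact: (e 2%N 0%N).1.
  + exact: (e 3%N 0%N).1.
  + exact: (e 4%N 0%N).1.
  + exact: (e 5%N 0%N).1.
  + exact: (e 6%N 0%N).1.
(* From pairs back to subspaces: [Y] itself, with evaluation as the separately continuous function,
   serves as the second space. *)
- move=> H Y pcY; have tY := set_Cp_tychonoff Y; have e := pair _ tY pcY.
  have GP : Grothendieck_pair R (set_type Y) X.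
    case: (H _ tY pcY) => [|[//|[|]]].
    + exact: (e 0%N 1%N).1.
    + exact: (e 2%N 1%N).1.
    + exact: (e 3%N 1%N).1.
  apply/(compact_closure_limits pcY).
  by move/Grothendieck_pair_limits: GP; apply=> //; exact: eval_on_sep.
Qed.
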